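(* Let $U$ be any ground state of $-\Delta\phi=g(\phi)$ in $\mathbb R^N$, and let $A_g=A(U)=Nc_g$. Consider the generalized Kirchhoff problem \[ (\mathrm K_\theta)\qquad -\Bigl(a+b\Bigl(\int_{\mathbb R^N}|\nabla u|^2dx\Bigr)^\theta\Bigr)\Delta u=g(u)\quad\text{in }\mathbb R^N,\qquad b\ge0 . \] (i) If $\theta(N-2)>2$, every ground-state branch has the same nondegenerate turning value \[ b_g^*=\frac{C_{a,N,\theta}}{A_g^\theta}=\sup_{\phi\in\mathcal P}b_\phi^*, \] and $b_g^*$ is the global upper existence threshold: $(\mathrm K_\theta)$ has no nontrivial solution for $b>b_g^*$. (ii) If $\theta(N-2)=2$, the value $b_g^{0}=A_g^{-\theta}$ is the sharp nonattained global upper existence threshold: every ground-state branch realizes each $0\le b<b_g^0$, whereas $(\mathrm K_\theta)$ has no nontrivial solution for $b\ge b_g^0$. (iii) If $\theta(N-2)<2$, $(\mathrm K_\theta)$ has no finite upper threshold, and every ground-state branch contains exactly one solution for every $b\ge0$.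
   Context: $N\ge3$, $a>0$, $\theta>0$. The function $g\in C(\mathbb R,\mathbb R)$ is odd and satisfies the Berestycki–Lions hypotheses: $-\infty<\liminf_{s\to0^+}g(s)/s\le\limsup_{s\to0^+}g(s)/s=-m<0$; $-\infty\le\limsup_{s\to+\infty}g(s)/s^{(N+2)/(N-2)}\le0$; and there is $\zeta>0$ with $G(\zeta)>0$, where $G(t)=\int_0^tg(\tau)\,d\tau$. Set $A(u)=\int_{\mathbb R^N}|\nabla u|^2dx$, $\mathcal B(u)=\int_{\mathbb R^N}G(u)\,dx$, and $\mathcal D_G=\{u\in H^1(\mathbb R^N)\setminus\{0\}:\mathcal B(u)\in\mathbb R\}$. Solutions are weak (distributional) solutions; by convention, nontrivial solutions of $(\mathrm K_\theta)$ and of $-\Delta\phi=g(\phi)$ are elements of $\mathcal D_G$ having the regularity required for validity of the Pohozaev identity ($\frac{N-2}{2}(aA(u)+bA(u)^{\theta+1})=N\mathcal B(u)$, respectively $\frac{N-2}{2}A(\phi)=N\mathcal B(\phi)$). $\mathcal P=\{\phi\in\mathcal D_G:-\Delta\phi=g(\phi)\text{ in }\mathbb R^N\}$, $J(\phi)=\frac12A(\phi)-\mathcal B(\phi)$, $c_g=\inf_{\phi\in\mathcal P}J(\phi)$; a ground state is a positive radial $U\in\mathcal P$ with $J(U)=c_g$ (such $U$ exist by Berestycki–Lions). Each $\phi\in\mathcal P$ generates the exact spatial branch $\Gamma_\phi=\{(b_\phi(s),\phi(s\,\cdot)):0<s\le a^{-1/2}\}$ of solutions of $(\mathrm K_\theta)$,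 with $b_\phi(s)=\frac{1-as^2}{A(\phi)^\theta}s^{\theta(N-2)-2}$; a ground-state branch is $\Gamma_U$ with $U$ a ground state. For $\theta(N-2)>2$, $b_\phi$ has a unique critical point $s_*=\bigl(\frac{\theta(N-2)-2}{a\theta(N-2)}\bigr)^{1/2}$, a maximum with $b_\phi''(s_* )<0$; the turning value of $\Gamma_\phi$ is $b_\phi^*=b_\phi(s_* )$; and \[ C_{a,N,\theta}=\frac{2}{\theta(N-2)}\Bigl(\frac{\theta(N-2)-2}{a\theta(N-2)}\Bigr)^{\frac{\theta(N-2)-2}{2}} . \] *)

(* Defs.v *)
From HB Require Import structures.
From mathcomp Require Import all_boot all_order all_algebra.
From mathcomp Require Import all_classical all_reals all_analysis.

Set Implicit Arguments.
Unset Strict Implicit.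
Unset Printing Implicit Defensive.

Import Order.TTheory GRing.Theory Num.Theory.
Import numFieldNormedType.Exports.

Local Open Scope classical_set_scope.
Local Open Scope ring_scope.

(* R^n is 'rV[R]_n. The library norm on it is the sup norm, used here only
   through the topology; the Euclidean norm is [enorm]. *)

Definition rV_display : measure_display.
Proof. exact: default_measure_display. Qed.

Section measurable_rV.
Context (R : realType) (n : nat).

Let coors : 'I_n -> 'rV[R]_n -> R := fun i x => x ord0 i.

Let rV_set0 : g_sigma_preimage coors set0.
Proof. exact: sigma_algebra0. Qed.

Let rV_setC A : g_sigma_preimage coors A -> g_sigma_preimage coors (~` A).
Proof. exact: sigma_algebraC. Qed.

Let rV_bigcup (F : _^nat) : (forall i, g_sigma_preimage coors (F i)) ->
  g_sigma_preimage coors (\bigcup_i (F i)).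
Proof. exact: sigma_algebra_bigcup. Qed.

HB.instance Definition _ := @isMeasurable.Build rV_display
  'rV[R]_n (g_sigma_preimage coors) rV_set0 rV_setC rV_bigcup.

Lemma measurable_coord (i : 'I_n) :
  measurable_fun [set: 'rV[R]_n] (fun x : 'rV[R]_n => x ord0 i).
Proof.
move=> _ B mB; rewrite setTI; apply: sub_sigma_algebra => /=.
rewrite -bigcup_seq/=; exists i => /=; first by rewrite mem_index_enum.
by exists B => //; rewrite setTI.
Qed.

Lemma measurable_fun_rV d (T : measurableType d) (f : T -> 'rV[R]_n) :
  (forall i, measurable_fun [set: T] (fun t => f t ord0 i)) ->
  measurable_fun [set: T] f.
Proof.
move=> mf _ A mA; rewrite setTI.
suff : preimage_set_system setT f (g_sigma_preimage coors) `<=` measurable.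
  by apply; exists A => //; rewrite setTI.
rewrite -g_sigma_preimage_comp.
apply: smallest_sub; first exact: sigma_algebra_measurable.
rewrite -bigcup_seq; apply: bigcup_sub => i _ _ [B mB <-].
exact: mf.
Qed.

End measurable_rV.

Section lebesgue_rV.
Context (R : realType).

Definition consrV n (p : measurableTypeR R * 'rV[R]_n) : 'rV[R]_n.+1 :=
  \row_i if unlift ord0 i is Some j then p.2 ord0 j else p.1.

Definition unconsrV n (x : 'rV[R]_n.+1) : measurableTypeR R * 'rV[R]_n :=
  (x ord0 ord0, \row_j x ord0 (lift ord0 j)).

Lemma measurable_consrV n : measurable_fun setT (@consrV n).
Proof.
apply: measurable_fun_rV => i; under eq_fun do rewrite mxE.
case: unliftP => [j|] _; last exact: measurable_fst.
exact: (measurableT_comp (measurable_coord j) measurable_snd).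
Qed.

HB.instance Definition _ n :=
  isMeasurableFun.Build _ _ _ _ (@consrV n) (@measurable_consrV n).

Lemma consrVK n : cancel (@consrV n) (@unconsrV n).
Proof.
move=> [x v]; rewrite /unconsrV !mxE unlift_none; congr pair.
by apply/rowP => j; rewrite !mxE liftK.
Qed.

Lemma measurable_unconsrV n : measurable_fun setT (@unconsrV n).
Proof.
apply/measurable_fun_pairP; split; first exact: measurable_coord.
apply: measurable_fun_rV => i /=; under eq_fun do rewrite mxE.
exact: measurable_coord.
Qed.

Section lebS.
Context n (m : {sigma_finite_measure set 'rV[R]_n -> \bar R}).

Definition lebS : set 'rV[R]_n.+1 -> \bar R :=
  pushforward (@lebesgue_measure R \x m)%E (@consrV n).

Let lebS0 : lebS set0 = 0%E.
Proof. by rewrite /lebS /pushforward preimage_set0 measure0. Qed.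

Let lebS_ge0 A : (0 <= lebS A)%E.
Proof. exact: measure_ge0. Qed.

Let lebS_sigma_additive : semi_sigma_additive lebS.
Proof.
exact: (@measure_semi_sigma_additive _ _ _
  (measure_function_pushforward__canonical__measure_function_Measure
     (@lebesgue_measure R \x m)%E (@measurable_consrV n))).
Qed.

HB.instance Definition _ :=
  isMeasure.Build _ _ _ lebS lebS0 lebS_ge0 lebS_sigma_additive.

Let lebS_sigma_finite : sigma_finite setT lebS.
Proof.
have /sigma_finiteP[F [TF ndF Foo]] := sigma_finiteT (@lebesgue_measure R).
have /sigma_finiteP[G [TG ndG Goo]] := sigma_finiteT m.
exists (fun k => @unconsrV n @^-1` (F k `*` G k)).
  rewrite -preimage_bigcup -[LHS](preimage_setT (@unconsrV n)); congr (_ @^-1` _).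
  rewrite -setXTT TF TG predeqE => -[x y]; split.
    move=> [/= [i _ Fix] [j _ Gjy]]; exists (maxn i j) => //; split.
    - by move: x Fix; exact/subsetPset/ndF/leq_maxl.
    - by move: y Gjy; exact/subsetPset/ndG/leq_maxr.
  by move=> [i _ []/= ? ?]; split; exists i.
move=> k; have [mF Fk] := Foo k; have [mG Gk] := Goo k; split.
  rewrite -[X in measurable X]setTI; apply: measurable_unconsrV => //.
  exact: measurableX.
rewrite /lebS /pushforward -comp_preimage.
rewrite (_ : _ \o _ = id) ?preimage_id; last exact/funext/consrVK.
by rewrite product_measure1E// lte_mul_pinfty// ge0_fin_numE.
Qed.

HB.instance Definition _ :=
  Measure_isSigmaFinite.Build _ _ _ lebS lebS_sigma_finite.

End lebS.

(* Lebesgue measure on R^n, as the n-fold product of the one on R. *)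
Fixpoint leb n : {sigma_finite_measure set 'rV[R]_n -> \bar R} :=
  match n with
  | 0 => \d_(0 : 'rV[R]_0)
  | k.+1 => lebS (leb k)
  end.

End lebesgue_rV.

Section function_spaces.
Context (R : realType) (N : nat).
Implicit Types (u psi : 'rV[R]_N -> R) (d : 'rV[R]_N -> 'rV[R]_N).

Definition enorm (x : 'rV[R]_N) : R := Num.sqrt (\sum_i x ord0 i ^+ 2).

Definition partial (i : 'I_N) psi : 'rV[R]_N -> R :=
  fun x => 'D_(delta_mx ord0 i) psi x.

Fixpoint Cn (k : nat) psi : Prop :=
  continuous psi /\
  match k with
  | 0 => True
  | j.+1 => forall i : 'I_N,
      (forall x, derivable psi x (delta_mx ord0 i)) /\ Cn j (partial i psi)
  end.

Definition test_function psi : Prop :=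
  (forall k, Cn k psi) /\ compact (closure [set x | psi x != 0]).

Definition is_weak_grad u d : Prop :=
  forall i : 'I_N,
    (fun x => d x ord0 i) \in Lfun (leb R N) 2%:E /\
    forall psi, test_function psi ->
      \int[leb R N]_x (u x * partial i psi x) =
      - \int[leb R N]_x (d x ord0 i * psi x).

(* The weak gradient is unique almost everywhere; one representative is
   chosen. *)
Definition weak_grad u : 'rV[R]_N -> 'rV[R]_N :=
  xget (fun=> 0) [set d | is_weak_grad u d].

(* The Sobolev space H^1(R^N); its elements are represented by functions. *)
Definition H1 u : Prop :=
  u \in Lfun (leb R N) 2%:E /\ exists d, is_weak_grad u d.

Definition dirichlet u : R :=
  \int[leb R N]_x (\sum_i weak_grad u x ord0 i ^+ 2).

Definition locally_integrable_rV u : Prop :=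
  forall K, compact K -> (leb R N).-integrable K (EFin \o u).

End function_spaces.

Section problem.
Context (R : realType).

Definition berestycki_lions_zero (g : R -> R) : Prop :=
  exists2 m : R, 0 < m &
    (-oo < limf_einf (fun s => (g s / s)%:E) (0 : R)^'+)%E /\
    limf_esup (fun s => (g s / s)%:E) (0 : R)^'+ = (- m)%:E.

(* -oo <= limsup is automatic, and is therefore not stated. *)
Definition berestycki_lions_infty (N : nat) (g : R -> R) : Prop :=
  (limf_esup (fun s => (g s / s `^ ((N%:R + 2) / (N%:R - 2)))%:E)
     (pinfty_nbhs R) <= 0)%E.

Definition primitive (g : R -> R) (t : R) : R :=
  if 0 <= t then \int[@lebesgue_measure R]_(s in `[0, t]) g s
  else - \int[@lebesgue_measure R]_(s in `[t, 0]) g s.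

Definition berestycki_lions (N : nat) (g : R -> R) : Prop :=
  [/\ continuous g, (forall s, g (- s) = - g s), berestycki_lions_zero g,
      berestycki_lions_infty N g &
      exists2 zeta, 0 < zeta & 0 < primitive g zeta].

Context (N : nat) (g : R -> R).
Implicit Types (u phi : 'rV[R]_N -> R).

Definition potential u : \bar R :=
  (\int[leb R N]_x (primitive g (u x))%:E)%E.

Definition D_G u : Prop :=
  [/\ H1 u, ~ {ae leb R N, forall x, u x = 0} & potential u \is a fin_num].

(* Weak solutions of - c \Delta u = g(u), with c constant. *)
Definition weak_solution (c : R) u : Prop :=
  locally_integrable_rV (g \o u) /\
  forall psi, test_function psi ->
    c * \int[leb R N]_x (\sum_i weak_grad u x ord0 i * partial i psi x) =
    \int[leb R N]_x (g (u x) * psi x).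

(* By convention nontrivial solutions are regular enough for the Pohozaev
   identity to hold; this is rendered by making the identity itself (the last
   conjunct here and in [kirchhoff]) part of the solution class. *)
Definition P_set : set ('rV[R]_N -> R) := [set phi |
  [/\ D_G phi, weak_solution 1 phi &
      (N%:R - 2) / 2 * dirichlet phi = N%:R * fine (potential phi)]].

Definition action phi : R := dirichlet phi / 2 - fine (potential phi).

Definition c_g : \bar R := ereal_inf [set (action phi)%:E | phi in P_set].

Definition radial u : Prop :=
  exists f : R -> R, {ae leb R N, forall x, u x = f (enorm x)}.

Definition ground_state phi : Prop :=
  [/\ P_set phi, {ae leb R N, forall x, 0 < phi x}, radial phi &
      (action phi)%:E = c_g].

Context (a theta : R).

Definition kirchhoff (b : R) u : Prop :=
  [/\ 0 <= b, D_G u,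
      weak_solution (a + b * dirichlet u `^ theta) u &
      (N%:R - 2) / 2 * (a * dirichlet u + b * dirichlet u `^ (theta + 1)) =
      N%:R * fine (potential u)].

(* The upper existence threshold sup {b >= 0 | (K_theta) has a nontrivial
   solution}; it is +oo when there is no finite one. *)
Definition upper_threshold : \bar R :=
  ereal_sup [set b%:E | b in [set b | exists u, kirchhoff b u]].

Definition b_curve phi (s : R) : R :=
  (1 - a * s ^+ 2) / dirichlet phi `^ theta * s `^ (theta * (N%:R - 2) - 2).

Definition s_range : set R := `]0, a `^ (- 2^-1)].

Definition branch phi : set (R * ('rV[R]_N -> R)) :=
  [set (b_curve phi s, fun x => phi (s *: x)) | s in s_range].

Definition s_star : R :=
  ((theta * (N%:R - 2) - 2) / (a * (theta * (N%:R - 2)))) `^ 2^-1.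

Definition turning_value phi : R := b_curve phi s_star.

Definition nondegenerate_turning_point (f : R -> R) (I : set R) (s : R) :=
  [/\ I s, is_derive s 1 f 0,
      (forall t, I t -> is_derive t 1 f 0 -> t = s),
      (forall t, I t -> f t <= f s) &
      exists2 d, d < 0 & is_derive s 1 (derive1 f) d].

Definition C_const : R :=
  2 / (theta * (N%:R - 2)) *
  ((theta * (N%:R - 2) - 2) / (a * (theta * (N%:R - 2))))
    `^ ((theta * (N%:R - 2) - 2) / 2).

End problem.

Arguments P_set {R} N g.
Arguments c_g {R} N g.
Arguments upper_threshold {R} N g a theta.
Arguments s_star {R} N a theta.
Arguments C_const {R} N a theta.

(* Main.v *)
From HB Require Import structures.
Require Import Defs.
From mathcomp Require Import all_boot all_order all_algebra.
From mathcomp Require Import all_classical all_reals all_analysis.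
From mathcomp Require Import measurable_realfun.
From mathcomp Require Import ring lra.

Set Implicit Arguments.
Unset Strict Implicit.
Unset Printing Implicit Defensive.

Import Order.TTheory GRing.Theory Num.Theory.
Import numFieldNormedType.Exports.

Local Open Scope classical_set_scope.
Local Open Scope ring_scope.

(** The Dirichlet integral of [u (s x)] is [s^(2-N)] times that of [u], its
    potential is [s^(-N)] times that of [u], and it solves the equation with the
    diffusion constant divided by [s^2]. Hence a solution [u] of the Kirchhoff
    problem, with effective constant [c = a + b A(u)^theta], becomes a solution of
    [- Delta phi = g(phi)] after dilation by [sqrt c]; conversely every [phi] in
    [P_set] produces the solutions of its branch. So the Kirchhoff problem at [b]
    is solvable exactly when [b = b_curve phi s] for some [phi] in [P_set] and
    some admissible [s] ([branch_kirchhoff], [kirchhoff_branch]).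

    The Pohozaev identity gives [J(phi) = A(phi) / N] on [P_set]. A ground state
    therefore minimizes [A] over [P_set], and all ground states have the same
    [A]. Since [b_curve phi s] is [A(phi)^(-theta)] times a function of [s]
    alone, all thresholds reduce to the study of [(1 - a s^2) s^alpha] with
    [alpha = theta (N - 2) - 2] on the interval of the [s] with [a s^2 <= 1]. For
    [alpha > 0] the critical point is explicit and the maximality of its value is
    the inequality [y^k (1 + (1 - y) k) <= 1], a consequence of
    [1 + z <= exp z]. For [alpha = 0] the function decreases from a supremum at
    [s = 0], which is not attained. For [alpha < 0] it is a decreasing bijection
    onto the nonnegative reals.

    Two analytic facts support this reduction.

    - The Dirichlet integral is computed from a chosen weak gradient, so its
      behaviour under dilations rests on the almost everywhere uniqueness of weak
      gradients ([weak_grad_unique]). This follows from [fundamental_lemma]: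
      smooth bumps converge to indicators of boxes, and boxes form a generating
      pi-system.

    - Dividing by [A(phi)^theta] is meaningful because [A > 0] on [P_set]. By
      minimality it suffices to treat a ground state, which is positive almost
      everywhere, and [H1_gt0_dirichlet] shows that a positive function of H^1
      cannot have zero gradient: up to a constant, its mass in a fixed cube would
      be bounded by its mass in a slab of length [w] divided by [w], which tends
      to zero as [w] grows when the function is square integrable. *)

(** * Boxes and Lebesgue measure *)

Section boxes.
Context (R : realType).

Definition box n (l u : 'I_n -> R) : set 'rV[R]_n :=
  [set x | forall i, l i < x ord0 i < u i].

Lemma boxI n (l1 u1 l2 u2 : 'I_n -> R) :
  box l1 u1 `&` box l2 u2 =
  box (fun i => Num.max (l1 i) (l2 i)) (fun i => Num.min (u1 i) (u2 i)).
Proof.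
apply/seteqP; split=> [x [h1 h2] i|x h].
  have /andP[a b] := h1 i; have /andP[c d] := h2 i.
  by rewrite gt_max lt_min a b c d.
by split=> i; have := h i; rewrite gt_max lt_min => /andP[/andP[a b] /andP[c d]]; apply/andP.
Qed.

Lemma box_setI n (l u : 'I_n -> R) :
  box l u = \bigcap_(i in [set: 'I_n]) ((fun x : 'rV[R]_n => x ord0 i) @^-1` `]l i, u i[).
Proof.
apply/seteqP; split=> [x h i _ /=|x h i]; first by rewrite in_itv /= h.
by have := h i I; rewrite /= in_itv.
Qed.

Lemma measurable_box n (l u : 'I_n -> R) : measurable (box l u).
Proof.
rewrite box_setI; apply: fin_bigcap_measurable => [|i _]; first exact: finite_finset.
by rewrite -[X in measurable X]setTI; exact: measurable_coord.
Qed.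

Definition boxes n : set (set 'rV[R]_n) :=
  [set B | exists l u : 'I_n -> R, B = box l u].

Lemma setI_closed_boxes n : setI_closed (boxes (n := n)).
Proof.
move=> _ _ [l1 [u1 ->]] [l2 [u2 ->]]; rewrite boxI.
by do 2 eexists; reflexivity.
Qed.

Definition cube n (k : nat) : set 'rV[R]_n := box (fun=> - k%:R) (fun=> k%:R).

Arguments cube n k : clear implicits.

Lemma norm_coord_le n (x : 'rV[R]_n) i : `|x ord0 i| <= `|x|.
Proof.
rewrite [leRHS]/Num.norm/= mx_normE -[leLHS]nngE num_le.
by apply: le_trans (le_bigmax _ _ (ord0, i)).
Qed.

Lemma bigcup_cube n : \bigcup_k cube n k = setT.
Proof.
apply/seteqP; split=> // x _; exists (Num.truncn `|x|).+1 => // i.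
by rewrite -ltr_norml (le_lt_trans (norm_coord_le x i))// truncnS_gt.
Qed.

(** The half-spaces bounding one coordinate from below generate the
    sigma-algebra, and each of them is the union of the boxes bounded by [k] in
    absolute value in all other directions. *)
Lemma measurable_rV_boxes n : @measurable _ 'rV[R]_n = <<s @boxes n >>.
Proof.
apply/seteqP; split; last first.
  by apply: smallest_sub => [|_ [l [u ->]]];
    [exact: sigma_algebra_measurable|exact: measurable_box].
apply: smallest_sub; first exact: smallest_sigma_algebra.
rewrite -bigcup_seq; apply: bigcup_sub => i _ _ [B mB <-].
pose f : g_sigma_algebraType (@boxes n) -> R := fun x : 'rV[R]_n => x ord0 i.
suff : measurable_fun setT f by apply.
apply: (measurability _ (RGenOInfty.measurableE R)).
move=> _ [_ [a ->] <-]; rewrite setTI.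
rewrite (_ : f @^-1` _ = \bigcup_k box
   (fun j => if j == i then a else - k%:R) (fun j => k%:R)); last first.
  apply/seteqP; split=> [x /=|x [k _ /(_ i)]]; rewrite /= in_itv /= andbT /f; last first.
    by rewrite eqxx => /andP[].
  move=> ax; exists (Num.truncn `|x|).+1 => // j.
  have := le_lt_trans (norm_coord_le x j) (truncnS_gt _).
  by rewrite ltr_norml => /andP[h ->]; rewrite andbT; case: eqP => [->|].
apply: bigcupT_measurable => k; apply: sub_sigma_algebra.
by do 2 eexists; reflexivity.
Qed.

(** The truncation at 0 accounts for the empty boxes, which cannot be avoided
    since boxes are to be closed under intersection. *)
Lemma leb_box n (l u : 'I_n -> R) :
  leb R n (box l u) = (\prod_i Num.max 0 (u i - l i))%:E.
Proof.
elim: n l u => [|n IH] l u.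
  rewrite big_ord0 /= diracE mem_set //.
  by case.
have -> : leb R n.+1 (box l u) =
   (@lebesgue_measure R \x leb R n)%E (@consrV R n @^-1` box l u) by [].
rewrite (_ : _ @^-1` _ = `]l ord0, u ord0[%classic `*`
    box (fun j => l (lift ord0 j)) (fun j => u (lift ord0 j))); last first.
  apply/seteqP; split=> [[t y] h|[t y] [/= h1 h2] i].
    split=> [|j] /=; last by have := h (lift ord0 j); rewrite mxE liftK.
    by have := h ord0; rewrite mxE unlift_none /= in_itv.
  rewrite mxE; case: unliftP => [j ->|->] /=; first exact: h2.
  by move: h1; rewrite in_itv.
rewrite product_measure1E//; last exact: measurable_box.
rewrite [X in (_ * X)%E]IH.
have E1 := lebesgue_measure_itv `]l ord0, u ord0[.
rewrite [X in (X * _)%E]E1 /= lte_fin big_ord_recl.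
case: ltP => h; last first.
  by rewrite mul0e max_l ?mul0r// subr_le0.
by rewrite max_r// subr_ge0 ltW.
Qed.

Lemma leb_box_lty n (l u : 'I_n -> R) : (leb R n (box l u) < +oo)%E.
Proof. by rewrite leb_box ltry. Qed.

(** Boxes form a generating pi-system exhausted by the cubes. Both the dilation
    formula and the fundamental lemma are comparisons of two measures on boxes. *)
Lemma rV_measure_unique n (m1 m2 : {measure set 'rV[R]_n -> \bar R}) :
  (forall l u : 'I_n -> R, m1 (box l u) = m2 (box l u)) ->
  (forall k, m1 (cube n k) < +oo)%E ->
  forall A, measurable A -> m1 A = m2 A.
Proof.
move=> m12 m1oo A mA.
apply: (measure_unique (@boxes n) (cube n)) => //.
- exact: measurable_rV_boxes.
- exact: setI_closed_boxes.
- by move=> i; do 2 eexists; reflexivity.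
- exact: bigcup_cube.
- by move=> _ [l [u ->]].
Qed.

Lemma measurable_scale n (s : R) : measurable_fun setT (fun x : 'rV[R]_n => s *: x).
Proof.
apply: measurable_fun_rV => i; under eq_fun do rewrite mxE.
by apply: measurable_funM => //; exact: measurable_coord.
Qed.

End boxes.
Arguments cube {R} n k.
(** * Integrals under dilations *)

Section scaling.
Context (R : realType) (n : nat).
Local Notation leb := (leb R n).

Definition dilate (s : R) (x : 'rV[R]_n) : 'rV[R]_n := s *: x.

HB.instance Definition _ s :=
  isMeasurableFun.Build _ _ _ _ (dilate s) (measurable_scale s).

Lemma leb_dilate (s : R) (A : set 'rV[R]_n) : 0 < s -> measurable A ->
  leb (dilate s @^-1` A) = ((s ^+ n)^-1%:E * leb A)%E.
Proof.
move=> s0 mA.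
have c0 : 0 <= (s ^+ n)^-1 by rewrite invr_ge0 exprn_ge0// ltW.
have Ebox (l u : 'I_n -> R) : dilate s @^-1` box l u =
    box (fun i => s^-1 * l i) (fun i => s^-1 * u i).
  apply/seteqP; split=> x h i; have := h i; rewrite /dilate /= mxE;
    by rewrite ltr_pdivrMl// ltr_pdivlMl.
apply: (@rV_measure_unique _ _ (pushforward leb (dilate s))
   (mscale (NngNum c0) leb)) => // [l u|k].
  change (leb (dilate s @^-1` box l u) = ((s ^+ n)^-1%:E * leb (box l u))%E).
  rewrite Ebox !leb_box -EFinM; congr EFin.
  rewrite -exprVn -[X in _ ^+ X](card_ord n) -prodr_const -big_split /=.
  apply: eq_bigr => i _; rewrite -mulrBr.
  by rewrite maxr_pMr ?mulr0// invr_ge0 ltW.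
change (leb (dilate s @^-1` cube n k) < +oo)%E.
by rewrite Ebox leb_box ltry.
Qed.

(** The positive and the negative part scale separately, and a positive factor
    distributes over their difference even when both integrals are infinite.
    Hence the formula covers the potential, whose integral may diverge. *)
Lemma integral_dilate (s : R) (F : 'rV[R]_n -> \bar R) : 0 < s ->
  measurable_fun setT F ->
  (\int[leb]_x F (s *: x) = (s ^+ n)^-1%:E * \int[leb]_x F x)%E.
Proof.
move=> s0 mF.
have c0 : 0 < (s ^+ n)^-1 by rewrite invr_gt0 exprn_gt0.
have ge0 (f : 'rV[R]_n -> \bar R) : measurable_fun setT f ->
    (forall x, 0 <= f x)%E ->
    (\int[leb]_x f (s *: x) = (s ^+ n)^-1%:E * \int[leb]_x f x)%E.
  move=> mf f0.
  have -> : (\int[leb]_x f (s *: x))%E =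
     (\int[pushforward leb (dilate s)]_x f x)%E.
    by rewrite ge0_integral_pushforward.
  pose c : {nonneg R} := NngNum (ltW c0).
  rewrite -[(s ^+ n)^-1]/(c%:num) -ge0_integral_mscale//.
  by apply: eq_measure_integral => A mA _; exact: leb_dilate.
rewrite [LHS]integralE [X in (_ * X)%E]integralE.
rewrite (_ : (\int[leb]_x _)%E = (\int[leb]_x F^\+ (s *: x))%E); last first.
  by apply: eq_integral => x _; rewrite !funeposE.
rewrite (_ : (\int[leb]_x (fun y => F (s *: y))^\- x)%E =
   (\int[leb]_x F^\- (s *: x))%E); last first.
  by apply: eq_integral => x _; rewrite !funenegE.
rewrite !ge0//; [|exact: measurable_funeneg|exact: measurable_funepos].
have : (0 <= \int[leb]_x F^\+ x)%E by exact: integral_ge0.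
have : (0 <= \int[leb]_x F^\- x)%E by exact: integral_ge0.
case: (\int[leb]_x F^\- x)%E => [b| |] // _; case: (\int[leb]_x F^\+ x)%E => [d| |] // _.
- by rewrite -EFinB -EFinM mulrBr EFinB.
- by rewrite /= gt0_muley ?lte_fin.
- by rewrite /= gt0_muley ?lte_fin//= gt0_muleNy ?lte_fin.
- by rewrite /= gt0_muley ?lte_fin//= gt0_muleNy ?lte_fin.
Qed.

Lemma Rintegral_dilate (s : R) (F : 'rV[R]_n -> R) : 0 < s ->
  measurable_fun setT F ->
  \int[leb]_x F (s *: x) = (s ^+ n)^-1 * \int[leb]_x F x.
Proof.
move=> s0 mF; rewrite /Rintegral.
rewrite (@integral_dilate s (EFin \o F))//; last exact/measurable_EFinP.
have c0 : 0 < (s ^+ n)^-1 by rewrite invr_gt0 exprn_gt0.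
case: (\int[leb]_x _)%E => [r| |] //=.
- by rewrite gt0_muley ?lte_fin//= mulr0.
- by rewrite gt0_muleNy ?lte_fin//= mulr0.
Qed.

(** As for [integral_dilate], the factor passes through the positive and the
    negative part, and [fine] sends both infinite values to 0. *)
Lemma RintegralZ_gt0 (c : R) (F : 'rV[R]_n -> R) : 0 < c ->
  measurable_fun setT F -> \int[leb]_x (c * F x) = c * \int[leb]_x F x.
Proof.
move=> c0 mF; rewrite /Rintegral.
have mE : measurable_fun setT (EFin \o F) by exact/measurable_EFinP.
rewrite integralE [in RHS]integralE.
rewrite (_ : (fun x => (c * F x)%:E) = (fun x => c%:E * (EFin \o F) x)%E)//.
rewrite ge0_funeposM ?(ltW c0)// ge0_funenegM ?(ltW c0)//.
rewrite (ge0_integralZl_EFin _ _ _ (measurable_funeneg _)) ?(ltW c0)//.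
rewrite (ge0_integralZl_EFin _ _ _ (measurable_funepos _)) ?(ltW c0)//.
case: (\int[leb]_x _^\- x)%E => [b| |] //=; case: (\int[leb]_x _^\+ x)%E => [d| |] //=;
  rewrite ?gt0_muley ?gt0_muleNy ?lte_fin//= ?mulr0//.
by rewrite mulrBr.
Qed.

Lemma ae_dilate (s : R) (P : set 'rV[R]_n) : 0 < s ->
  {ae leb, forall x, P x} -> {ae leb, forall x, P (s *: x)}.
Proof.
move=> s0 [A [mA A0 PA]]; exists (dilate s @^-1` A); split.
- by rewrite -[X in measurable X]setTI; exact: measurable_scale.
- by rewrite leb_dilate// A0 mule0.
- by move=> x Px; exact: PA.
Qed.

End scaling.
(** * Measurability of continuous functions *)

Section continuous_rV.
Context (R : realType) (n : nat).

(** The sigma-algebra is generated by the coordinates, so the topology has to be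
    related to it: an open set is the countable union of the boxes with rational
    center and radius [1 / (k + 1)] that it contains. *)
Lemma open_rV_measurable (O : set 'rV[R]_n) : open O -> measurable O.
Proof.
move=> oO.
pose B (p : 'rV[rat]_n * nat) : set 'rV[R]_n :=
  box (fun i => ratr (p.1 ord0 i) - p.2.+1%:R^-1)
      (fun i => ratr (p.1 ord0 i) + p.2.+1%:R^-1).
pose F p := if `[< B p `<=` O >] then B p else set0.
have -> : O = \bigcup_p F p.
  apply/seteqP; split => [x Ox|x [p _]]; last first.
    by rewrite /F; case: asboolP => // h /h.
  have /nbhs_ballP[e /= e0 xe] : nbhs x O by exact: open_nbhs_nbhs.
  pose k := Num.truncn (2 / e).
  have k0 : 0 < k.+1%:R^-1 :> R by rewrite invr_gt0.
  have ke : k.+1%:R^-1 < e / 2.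
    by rewrite invf_plt ?posrE ?divr_gt0// invf_div truncnS_gt.
  have /choice[q qE] : forall i, exists q : rat,
      x ord0 i - k.+1%:R^-1 < ratr q < x ord0 i + k.+1%:R^-1.
    move=> i.
    have lt : x ord0 i - k.+1%:R^-1 < x ord0 i + k.+1%:R^-1.
      by rewrite ltrD2l gtrN.
    by have [q] := rat_in_itvoo lt; rewrite in_itv /=; exists q.
  exists (\row_i q i, k) => //.
  have -> : F (\row_i q i, k) = B (\row_i q i, k).
    rewrite /F asboolT // => y By; apply: xe; split => // i j.
    rewrite /ball /= ord1; have := By j; rewrite /= mxE => /andP[h1 h2].
    have /andP[h3 h4] := qE j.
    rewrite ltr_norml; move: h1 h2 h3 h4 ke.
    move: (_^-1) (ratr _) => d r h1 h2 h3 h4 ke.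
    apply/andP; split; lra.
  move=> i /=; rewrite mxE; have /andP[] := qE i.
  move: (_^-1) (ratr _) => d r h3 h4.
  apply/andP; split; lra.
apply: countable_bigcupT_measurable => // p.
by rewrite /F; case: asboolP => _ //; exact: measurable_box.
Qed.

Lemma continuous_rV_measurable (psi : 'rV[R]_n -> R) :
  continuous psi -> measurable_fun setT psi.
Proof.
move=> /continuousP cf; apply: (measurability _ (RGenOpens.measurableE R)).
by move=> _ [_ [a [b ->]] <-]; rewrite setTI; apply: open_rV_measurable; apply: cf; exact: interval_open.
Qed.

End continuous_rV.
(** * A flat function *)

Section flat.
Context (R : realType).

Lemma scaleRE (x y : R) : x *: y = x * y. Proof. by []. Qed.

(** The powers of [1 / t] are included because the derivative of [exp (- 1 / t)]
    involves them: the span of these functions is closed under differentiation,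
    so that smoothness is a plain induction. *)
Definition flat (m : nat) (t : R) : R :=
  if 0 < t then t^-1 ^+ m * expR (- t^-1) else 0.

Lemma flat_le0 m t : t <= 0 -> flat m t = 0.
Proof. by rewrite /flat ltNge => ->. Qed.

Lemma flat_gt0 m t : 0 < t -> 0 < flat m t.
Proof. by move=> t0; rewrite /flat t0 mulr_gt0 ?expR_gt0// exprn_gt0// invr_gt0. Qed.

Lemma flat_ge0 m t : 0 <= flat m t.
Proof. by have [/flat_le0->//|/(flat_gt0 m)/ltW] := leP t 0. Qed.

Lemma flat0_le1 t : flat 0 t <= 1.
Proof.
rewrite /flat; case: ifP => // t0.
by rewrite expr0 mul1r -expR0 ler_expR oppr_le0 invr_ge0 ltW.
Qed.

Lemma flat_bounded m t : flat m t <= m`!%:R.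
Proof.
have [/flat_le0->//|t0] := leP t 0.
rewrite /flat t0 expRN ler_pdivrMr ?expR_gt0//.
have s0 : 0 <= t^-1 by rewrite invr_ge0 ltW.
case: m => [|m]; first by rewrite expr0 mul1r -expR0 ler_expR.
have f0 : 0 < (m.+1)`!%:R :> R by rewrite ltr0n fact_gt0.
have /(le_trans _) : 1 + t^-1 ^+ m.+1 / m.+1`!%:R <= expR t^-1 := expR_ge1Dxn m s0.
by rewrite -ler_pdivrMl// mulrC; apply; rewrite lerDr.
Qed.

Lemma flatS m t : flat m.+1 t = t^-1 * flat m t.
Proof. by rewrite /flat; case: ifP => _; rewrite ?mulr0// exprS mulrA. Qed.

(** [flat m] is [t] times the bounded function [flat m.+1]. *)
Lemma flat_cvg0 m : flat m h @[h --> (0 : R)^'] --> (0 : R).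
Proof.
have f0 : 0 < m.+1`!%:R :> R by rewrite ltr0n fact_gt0.
apply/cvgrPdist_le => e e0; near=> h.
rewrite sub0r normrN ger0_norm ?flat_ge0//.
have [/flat_le0->|h0] := leP h 0; first exact: ltW.
have := flat_bounded m.+1 h; rewrite flatS ler_pdivrMl// => /le_trans; apply.
rewrite -ler_pdivlMr//; apply: le_trans (ler_norm _) _.
by near: h; apply: dnbhs0_le; exact: divr_gt0.
Unshelve. all: by end_near. Qed.

Definition dflat m t : R := flat m.+2 t - m%:R * flat m.+1 t.

(** At 0 the difference quotient of [flat m] is [flat m.+1], by [flatS]. *)
Lemma is_derive_flat (m : nat) (t : R) : is_derive t (1 : R) (flat m) (dflat m t).
Proof.
have [t0|t0|->] := ltgtP t 0.
- rewrite /dflat !flat_le0 ?(ltW t0)// mulr0 subr0.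
  apply: (near_eq_is_derive (f := cst (0 : R))).
  by near=> x; rewrite flat_le0// ltW//; near: x; exact: lt_nbhsl.
- pose f := (fun x : R => x^-1 ^+ m) * (fun x : R => expR (- x^-1)).
  apply: (near_eq_is_derive (f := f)).
    near=> x; rewrite /flat ifT//; near: x; exact: lt_nbhsr.
  have iV : is_derive t 1 (fun x : R => x^-1) (- t^-1 ^+ 2).
    rewrite exprVn; have := @is_deriveV R id t 1 1.
    rewrite /= [_ *: _]mulr1; by apply; exact: lt0r_neq0.
  have iX : is_derive t 1 (fun x : R => x^-1 ^+ m) (- (m%:R * t^-1 ^+ m.+1)).
    have := @is_deriveX _ _ (fun x : R => x^-1) m t 1 _ iV.
    rewrite exprfctE; move/is_derive_eq; apply.
    case: m {f} => [|m]; first by rewrite mulr0n !mul0r oppr0 [_ *: _]mul0r.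
    rewrite scaleRE /= !exprS; ring.
  have iE : is_derive t 1 (fun x : R => expR (- x^-1)) (expR (- t^-1) * t^-1 ^+ 2).
    apply: (is_derive1_comp (f := expR) (g := fun x => - x^-1)).
    rewrite -[t^-1 ^+ 2]opprK; exact: is_deriveN.
  have := is_deriveM iX iE; move/is_derive_eq; apply.
  rewrite /dflat /flat t0 !scaleRE /= !exprS; ring.
- rewrite /dflat !flat_le0// mulr0 subr0.
  have L : h^-1 *: ((flat m \o shift 0) (h *: 1) - flat m 0) @[h --> 0^'] --> 0.
    rewrite (_ : (fun h => _) = flat m.+1); first exact: flat_cvg0.
    apply/funext => h /=; rewrite (flat_le0 _ (lexx 0)) subr0 addr0 flatS.
    by rewrite [h *: 1]mulr1.
  by apply: DeriveDef; [apply/cvg_ex; exists 0|exact: cvg_lim L].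
Unshelve. all: by end_near. Qed.
End flat.
(** * Smooth functions of several variables *)

Section Cn_closure.
Context (R : realType) (N : nat).
Implicit Types (f g : 'rV[R]_N -> R).

Lemma Cn_continuous k f : Cn k f -> continuous f.
Proof. by case: k => [|k] []. Qed.

Lemma Cn_pred k f : Cn k.+1 f -> Cn k f.
Proof.
elim: k f => [|k IH] f [cf fk]; split=> // i.
by have [df /IH] := fk i.
Qed.

Lemma Cn_cst k (c : R) : Cn k (fun _ : 'rV[R]_N => c).
Proof.
elim: k c => [|k IH] c; split=> //; try exact: cst_continuous.
move=> i; split => [x|]; first exact: derivable_cst.
rewrite (_ : partial i _ = fun=> 0); first exact: IH.
by apply/funext => x; exact: derive_cst.
Qed.

Lemma Cn_add k f g : Cn k f -> Cn k g -> Cn k (fun x => f x + g x).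
Proof.
elim: k f g => [|k IH] f g [cf fk] [cg gk].
  by split=> // x; exact: (cvgD (cf x) (cg x)).
split=> [x|i]; first by exact: (cvgD (cf x) (cg x)).
have [df pf] := fk i; have [dg pg] := gk i.
split=> [x|]; first exact: derivableD.
rewrite (_ : partial i _ = fun x => partial i f x + partial i g x); first exact: IH.
by apply/funext => x; exact: deriveD.
Qed.

(** The Leibniz rule multiplies a factor by a derivative of the other one, so the
    induction needs the factors at order [k] as well as at order [k.+1]. *)
Lemma Cn_mul k f g : Cn k f -> Cn k g -> Cn k (fun x => f x * g x).
Proof.
elim: k f g => [|k IH] f g [cf fk] [cg gk].
  by split=> // x; exact: (cvgM (cf x) (cg x)).
split=> [x|i]; first by exact: (cvgM (cf x) (cg x)).
have [df pf] := fk i; have [dg pg] := gk i.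
split=> [x|]; first exact: derivableM.
rewrite (_ : partial i _ = fun x => f x * partial i g x + g x * partial i f x).
  by apply: Cn_add; apply: IH => //; apply: Cn_pred.
by apply/funext => x; exact: deriveM.
Qed.

Lemma Cn_prod k (I : finType) (F : I -> 'rV[R]_N -> R) :
  (forall i, Cn k (F i)) -> Cn k (fun x => \prod_i F i x).
Proof.
move=> kF.
elim: (index_enum I) => [|i s IH].
  rewrite (_ : (fun x => _) = fun=> 1); first exact: Cn_cst.
  by apply/funext => x; rewrite big_nil.
rewrite (_ : (fun x => _) = fun x => F i x * \prod_(j <- s) F j x).
  exact: Cn_mul.
by apply/funext => x; rewrite big_cons.
Qed.

Lemma differentiable_affine_coord (c d : R) (i : 'I_N) (x : 'rV[R]_N) :
  differentiable (fun y : 'rV[R]_N => c * y ord0 i + d) x.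
Proof.
apply: differentiableD; last exact: differentiable_cst.
apply: (@differentiableZ _ _ _ (fun y : 'rV[R]_N => y ord0 i)).
exact: differentiable_coord.
Qed.

Lemma is_derive_coord_comp (h : R -> R) (dh c d : R) (i j : 'I_N) (x : 'rV[R]_N) :
  is_derive (c * x ord0 i + d) (1 : R) h dh ->
  is_derive x (delta_mx ord0 j : 'rV[R]_N) (fun y => h (c * y ord0 i + d))
    ((i == j)%:R * c * dh).
Proof.
move=> hd.
have dh' : differentiable h (c * x ord0 i + d).
  by apply/derivable1_diffP; exact: ex_derive.
have da := differentiable_affine_coord c d i x.
have dd : differentiable (h \o (fun y : 'rV[R]_N => c * y ord0 i + d)) x.
  exact: differentiable_comp.
apply: DeriveDef; first exact: diff_derivable.
rewrite deriveE// diff_comp//=.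
have -> : 'd (fun y : 'rV[R]_N => c * y ord0 i + d) x (delta_mx ord0 j) =
    c * (i == j)%:R.
  rewrite -deriveE//; apply: lim_near_cst => //; near=> e.
  have e0 : e != 0 by near: e; exact: nbhs_dnbhs_neq.
  rewrite /= !mxE eqxx /= scaleRE.
  have -> : c * (e * (i == j)%:R + x ord0 i) + d - (c * x ord0 i + d) =
    e * (c * (i == j)%:R) by ring.
  by rewrite mulKf.
rewrite deriv1E; last by [].
rewrite scaleRE derive1E.
by rewrite derive_val [c * _]mulrC.
Unshelve. all: by end_near. Qed.

Lemma Cn_flat k m (c d : R) (i : 'I_N) :
  Cn k (fun x : 'rV[R]_N => flat m (c * x ord0 i + d)).
Proof.
have cc m' : continuous (fun x : 'rV[R]_N => flat m' (c * x ord0 i + d)).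
  move=> x; apply: (@continuous_comp _ _ _ (fun x : 'rV[R]_N => c * x ord0 i + d) (flat m')).
    exact: differentiable_continuous (differentiable_affine_coord c d i x).
  apply: differentiable_continuous; apply/derivable1_diffP.
  exact: (@ex_derive _ _ _ _ _ _ _ (is_derive_flat _ _)).
elim: k m => [|k IH] m; split=> // j.
have D (x : 'rV[R]_N) := is_derive_coord_comp j (is_derive_flat m (c * x ord0 i + d)).
split=> [x|]; first exact: (@ex_derive _ _ _ _ _ _ _ (D x)).
rewrite (_ : partial j _ = fun x => (i == j)%:R * c *
   (flat m.+2 (c * x ord0 i + d) + - m%:R * flat m.+1 (c * x ord0 i + d))).
  apply: Cn_mul; first exact: Cn_cst.
  apply: Cn_add => //; apply: Cn_mul => //; exact: Cn_cst.
apply/funext => x; rewrite mulNr; exact: (@derive_val _ _ _ _ _ _ _ (D x)).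
Qed.

End Cn_closure.
(** * Test functions *)

Section test_functions.
Context (R : realType) (N : nat).
Implicit Types (f g psi : 'rV[R]_N -> R).

Lemma compact_support psi (K : set 'rV[R]_N) : compact K ->
  (forall x, psi x != 0 -> K x) -> compact (closure [set x | psi x != 0]).
Proof.
move=> cK sub.
have /closure_id KE : closed K by apply: compact_closed => //; exact: norm_hausdorff.
apply: (@subclosed_compact _ _ K) => //; first exact: closed_closure.
by rewrite [X in _ `<=` X]KE; apply: closureS => x; exact: sub.
Qed.

Lemma test_function_measurable psi : test_function psi -> measurable_fun setT psi.
Proof. by move=> [/(_ 0%N)[cpsi _] _]; exact: continuous_rV_measurable. Qed.

Lemma partial_measurable psi i : test_function psi ->
  measurable_fun setT (partial i psi).
Proof.
move=> [/(_ 1%N)[_ /(_ i)[_ [cpsi _]]] _]; exact: continuous_rV_measurable.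
Qed.

(** Only directional derivatives are known to exist, so the chain rule is applied
    to the restriction of [psi] to the line through [c *: x] directed by [v]. *)
Lemma is_derive_dilate psi (c : R) (x v : 'rV[R]_N) :
  derivable psi (c *: x) v ->
  is_derive x v (fun y : 'rV[R]_N => psi (c *: y)) (c * 'D_v psi (c *: x)).
Proof.
move=> dpsi.
pose phi (h : R) := psi (h *: v + c *: x).
have dphi : derivable phi (0 : R) (1 : R) := (derivable1P psi (c *: x) v).1 dpsi.
have Dphi : 'D_v psi (c *: x) = 'D_(1 : R) phi (0 : R).
  rewrite /derive; set a := (fun _ : R => _); set b := (fun _ : R => _).
  suff -> : a = b by []; apply/funext => h; rewrite /a /b.
  by rewrite /phi /= scale0r addr0 add0r [h *: 1]mulr1.
pose phi' (h : R) := psi (c *: (h *: v + x)).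
have E : phi' = phi \o (fun h => c * h).
  by apply/funext => h; rewrite /phi' /phi /= scalerDr scalerA.
have D : is_derive (0 : R) (1 : R) phi' (c * 'D_v psi (c *: x)).
  rewrite E Dphi mulrC; apply: is_derive1_comp; last first.
    rewrite -[X in is_derive _ _ _ X]mulr1; exact: (@is_deriveZ _ _ _ id).
  by rewrite mulr0; exact: derivableP.
apply: DeriveDef.
  exact: (derivable1P (fun y : 'rV[R]_N => psi (c *: y)) x v).2 (@ex_derive _ _ _ _ _ _ _ D).
rewrite -(@derive_val _ _ _ _ _ _ _ D) /derive.
set a := (fun _ : R => _); set b := (fun _ : R => _).
suff -> : a = b by []; apply/funext => h; rewrite /a /b.
by rewrite /phi' /= scale0r addr0 add0r [h *: 1]mulr1.
Qed.

Lemma partial_dilate psi (c : R) i : Cn 1 psi ->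
  partial i (fun y : 'rV[R]_N => psi (c *: y)) = fun x => c * partial i psi (c *: x).
Proof.
move=> [_ /(_ i)[d _]]; apply/funext => x.
exact: (@derive_val _ _ _ _ _ _ _ (is_derive_dilate (d _))).
Qed.

Lemma Cn_dilate k psi (c : R) : Cn k psi -> Cn k (fun x : 'rV[R]_N => psi (c *: x)).
Proof.
have cc f : continuous f -> continuous (fun x : 'rV[R]_N => f (c *: x)).
  by move=> cf x; apply: (@continuous_comp _ _ _ (fun y : 'rV[R]_N => c *: y) f);
    [exact: scaler_continuous|exact: cf].
elim: k psi => [|k IH] psi [cpsi kpsi]; split => //; try exact: cc.
move=> i; have [d /IH pk] := kpsi i; split=> [x|].
  exact: (@ex_derive _ _ _ _ _ _ _ (is_derive_dilate (d _))).
rewrite (_ : partial i _ = fun x : 'rV[R]_N => c * partial i psi (c *: x)).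
  by apply: Cn_mul => //; exact: Cn_cst.
apply/funext => x.
exact: (@derive_val _ _ _ _ _ _ _ (is_derive_dilate (d _))).
Qed.

Lemma test_function_dilate psi (c : R) : c != 0 -> test_function psi ->
  test_function (fun x => psi (c *: x)).
Proof.
move=> c0 [kpsi cpsi]; split=> [k|]; first exact/Cn_dilate/kpsi.
apply: (@compact_support _ ((fun y : 'rV[R]_N => c^-1 *: y) @` closure [set x | psi x != 0])).
  by apply: continuous_compact => //; apply: continuous_subspaceT; exact: scaler_continuous.
move=> x px; exists (c *: x); first exact: subset_closure.
by rewrite scalerA mulVf// scale1r.
Qed.

(** The slopes [c] and [d] of the two sides are free: steep sides on both ends
    approximate the indicator of the box, while a gentle upper side in one
    direction makes the derivative in that direction small near the upper end. *)
Definition bump (l u c d : 'I_N -> R) (x : 'rV[R]_N) : R :=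
  \prod_j (flat 0 (c j * (x ord0 j - l j)) * flat 0 (d j * (u j - x ord0 j))).

Section bump.
Variables (l u c d : 'I_N -> R).
Hypotheses (c0 : forall i, 0 < c i) (d0 : forall i, 0 < d i).

Lemma bump_ge0 x : 0 <= bump l u c d x.
Proof. by apply: prodr_ge0 => i _; rewrite mulr_ge0// flat_ge0. Qed.

Lemma bump_le1 x : bump l u c d x <= 1.
Proof.
rewrite /bump -[leRHS](@big1_eq _ 1 *%R _ (index_enum 'I_N) xpredT).
apply: ler_prod => i _; rewrite mulr_ge0 ?flat_ge0//=.
by rewrite mulr_ile1 ?flat_ge0 ?flat0_le1.
Qed.

Lemma bump_eq0 x : ~ box l u x -> bump l u c d x = 0.
Proof.
move=> /existsNP[i /negP]; rewrite negb_and -!leNgt => h.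
rewrite /bump (bigD1 i)//=; case/orP: h => h.
- by rewrite flat_le0 ?mul0r// pmulr_rle0// subr_le0.
- by rewrite (@flat_le0 _ _ (d i * _)) ?mulr0 ?mul0r// pmulr_rle0// subr_le0.
Qed.

Lemma Cn_bump k : Cn k (bump l u c d).
Proof.
apply: Cn_prod => i.
rewrite (_ : (fun x : 'rV[R]_N => _) = fun x =>
   flat 0 (c i * x ord0 i + - (c i * l i)) * flat 0 (- d i * x ord0 i + d i * u i)).
  by apply: Cn_mul; apply: (@Cn_flat R N k 0).
by apply/funext => x; rewrite mulrBr; congr (_ * flat 0 _); ring.
Qed.

Lemma test_function_bump : test_function (bump l u c d).
Proof.
split; first exact: Cn_bump.
apply: (@compact_support _ [set x | forall i, `[l i, u i]%classic (x ord0 i)]).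
  by apply: (@rV_compact R N (fun i => `[l i, u i]%classic)) => i; exact: segment_compact.
move=> x nz i; have [bx|/bump_eq0 h] := pselect (box l u x); last by rewrite h eqxx in nz.
by rewrite /= in_itv /=; have /andP[/ltW -> /ltW ->] := bx i.
Qed.

(** Only the factor of index [i] depends on the [i]-th coordinate. *)
Lemma partial_bump i x : partial i (bump l u c d) x =
  (c i * flat 2 (c i * (x ord0 i - l i)) * flat 0 (d i * (u i - x ord0 i))
   - d i * flat 0 (c i * (x ord0 i - l i)) * flat 2 (d i * (u i - x ord0 i))) *
  \prod_(j | j != i) (flat 0 (c j * (x ord0 j - l j)) * flat 0 (d j * (u j - x ord0 j))).
Proof.
pose F (y : 'rV[R]_N) := flat 0 (c i * y ord0 i + - (c i * l i)).
pose H (y : 'rV[R]_N) := flat 0 (- d i * y ord0 i + d i * u i).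
pose G (y : 'rV[R]_N) := \prod_(j | j != i)
  (flat 0 (c j * (y ord0 j - l j)) * flat 0 (d j * (u j - y ord0 j))).
have -> : bump l u c d = F * H * G.
  apply/funext => y; rewrite /bump (bigD1 i)//=.
  rewrite ![(_ * _) y]/(_ * _) /F /H; congr (flat 0 _ * flat 0 _ * _); ring.
have dF : is_derive x (delta_mx ord0 i : 'rV[R]_N) F _ :=
  is_derive_coord_comp i (is_derive_flat 0 (c i * x ord0 i + - (c i * l i))).
have dH : is_derive x (delta_mx ord0 i : 'rV[R]_N) H _ :=
  is_derive_coord_comp i (is_derive_flat 0 (- d i * x ord0 i + d i * u i)).
have dG : is_derive x (delta_mx ord0 i : 'rV[R]_N) G 0.
  have L : h^-1 *: ((G \o shift x) (h *: (delta_mx ord0 i : 'rV[R]_N)) - G x)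
      @[h --> 0^'] --> (0 : R).
    rewrite (_ : (fun h => _) = cst 0); first exact: cvg_cst.
    apply/funext => h /=; rewrite [X in X - _](_ : _ = G x) ?subrr ?scaler0//.
    apply: eq_bigr => j ji; rewrite !mxE /= (negbTE ji) mulr0 add0r.
    by [].
  by apply: DeriveDef; [apply/cvg_ex; exists 0|exact: cvg_lim L].
rewrite /partial; have := is_deriveM (is_deriveM dF dH) dG.
move=> /(@derive_val _ _ _ _ _ _ _) ->.
rewrite !scaleRE mulr0 add0r eqxx /dflat.
rewrite (_ : c i * x ord0 i + - (c i * l i) = c i * (x ord0 i - l i)); last by ring.
rewrite /F /H /= (_ : c i * x ord0 i + - (c i * l i) = c i * (x ord0 i - l i)); last by ring.
rewrite (_ : - d i * x ord0 i + d i * u i = d i * (u i - x ord0 i)); last by ring.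
rewrite -/(G x); ring.
Qed.

End bump.
End test_functions.
(** * Square integrable functions and integrals over boxes *)

Section L2.
Context (R : realType) (N : nat).
Local Notation mu := (leb R N).
Implicit Types (f g e : 'rV[R]_N -> R).

Lemma Lfun2P f : f \in Lfun mu 2%:E <->
  measurable_fun setT f /\ mu.-integrable setT (fun x => (f x ^+ 2)%:E).
Proof.
split=> [fL|[mf /integrableP[_ fi]]].
  split; last exact: Lfun2_integrable_sqr.
  by move: fL; rewrite inE => /andP[]; rewrite inE.
rewrite inE; apply/andP; split; rewrite inE//= /finite_norm unlock poweR_lty//.
apply: le_lt_trans fi; rewrite le_eqVlt; apply/orP; left; apply/eqP.
apply: eq_integral => x _.
by rewrite [RHS]gee0_abs ?lee_fin ?sqr_ge0//= (@powR_mulrn _ _ 2)// real_normK// num_real.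
Qed.

Lemma Lfun2_measurable f : f \in Lfun mu 2%:E -> measurable_fun setT f.
Proof. by move=> /Lfun2P[]. Qed.

Lemma Lfun2_le f g : measurable_fun setT f -> (forall x, `|f x| <= `|g x|) ->
  g \in Lfun mu 2%:E -> f \in Lfun mu 2%:E.
Proof.
move=> mf fg /Lfun2P[mg ig]; apply/Lfun2P; split=> //.
apply: le_integrable ig => //.
  by apply/measurable_EFinP; exact: measurable_funX.
move=> x _; rewrite !abse_EFin lee_fin !normrX.
by rewrite ler_pXn2r// nnegrE.
Qed.

Lemma indic_Lfun2 (l u : 'I_N -> R) : \1_(box l u) \in Lfun mu 2%:E.
Proof.
have m1 : measurable_fun setT (\1_(box l u) : _ -> R).
  by apply: measurable_indic; exact: measurable_box.
apply/Lfun2P; split=> //; apply/integrableP; split.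
  by apply/measurable_EFinP; exact: measurable_funX.
rewrite (eq_integral (fun x => (\1_(box l u) x)%:E)).
  by rewrite integral_indic ?setIT//; [exact: leb_box_lty|exact: measurable_box].
by move=> x _; rewrite gee0_abs ?lee_fin ?sqr_ge0// indicE; case: (_ \in _);
  rewrite ?expr1n ?expr0n.
Qed.

Lemma bump_le_indic (l u c d : 'I_N -> R) x : (forall i, 0 < c i) -> (forall i, 0 < d i) ->
  `|bump l u c d x| <= \1_(box l u) x.
Proof.
move=> c0 d0; rewrite ger0_norm ?bump_ge0// indicE.
have [bx|nbx] := pselect (box l u x); first by rewrite mem_set// bump_le1.
by rewrite memNset// bump_eq0.
Qed.

Lemma measurable_bump (l u c d : 'I_N -> R) : (forall i, 0 < c i) -> (forall i, 0 < d i) ->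
  measurable_fun setT (bump l u c d).
Proof. by move=> c0 d0; apply: test_function_measurable; exact: test_function_bump. Qed.

Lemma bump_Lfun2 (l u c d : 'I_N -> R) : (forall i, 0 < c i) -> (forall i, 0 < d i) ->
  bump l u c d \in Lfun mu 2%:E.
Proof.
move=> c0 d0; apply: (@Lfun2_le _ (\1_(box l u))) => [|x|]; last exact: indic_Lfun2.
  exact: measurable_bump.
exact: le_trans (bump_le_indic l u x c0 d0) (ler_norm _).
Qed.

Lemma Lfun2_mul_integrable f g : f \in Lfun mu 2%:E -> g \in Lfun mu 2%:E ->
  mu.-integrable setT (fun x => (f x * g x)%:E).
Proof. by move=> fL gL; apply: (Lfun1_integrable _ _).1; exact: Lfun2_mul_Lfun1. Qed.

Lemma flat0_cvg1 (t : R) : 0 < t -> flat 0 (n.+1%:R * t) @[n --> \oo] --> (1 : R).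
Proof.
move=> t0; rewrite (_ : (fun n => _) = fun n : nat => expR (- (n.+1%:R^-1 * t^-1))).
  rewrite -[X in _ --> X](@expR0 R) -[X in expR X]oppr0 -[X in - X](mul0r t^-1).
  apply: continuous_cvg; first exact: continuous_expR.
  by apply: cvgN; apply: cvgMr_tmp; exact: cvg_harmonic.
apply/funext => n; rewrite /flat mulr_gt0 ?ltr0n// expr0 mul1r invfM.
by [].
Qed.

Lemma cvg_prod (I : Type) (s : seq I) (F : I -> nat -> R) (a : I -> R) :
  (forall i, F i n @[n --> \oo] --> a i) ->
  (\prod_(i <- s) F i n) @[n --> \oo] --> \prod_(i <- s) a i.
Proof.
move=> Fa; elim: s => [|i s IH].
  by rewrite big_nil; apply: cvg_near_cst; apply: nearW => n; rewrite big_nil.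
rewrite big_cons (_ : (fun n => _) = fun n => F i n * \prod_(j <- s) F j n).
  exact: cvgM.
by apply/funext => n; rewrite big_cons.
Qed.

Lemma bump_cvg (l u : 'I_N -> R) x :
  bump l u (fun=> n.+1%:R) (fun=> n.+1%:R) x @[n --> \oo] --> (\1_(box l u) x : R).
Proof.
have [bx|nbx] := pselect (box l u x); last first.
  rewrite indicE memNset//; apply: cvg_near_cst; apply: nearW => n.
  by rewrite bump_eq0// => i; rewrite ltr0n.
rewrite indicE mem_set//= /bump.
rewrite -[X in _ --> X](@big1_eq _ 1 *%R _ (index_enum 'I_N) xpredT).
apply: cvg_prod => i; rewrite -[X in _ --> X]mulr1.
have /andP[h1 h2] := bx i.
by apply: cvgM; apply: flat0_cvg1; rewrite subr_gt0.
Qed.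

(** Bumps with slopes tending to infinity converge to the indicator of the box
    while staying below it; dominated convergence applies with the dominating
    function [`|e|] restricted to the box. *)
Lemma integral_box_eq0 e (l u : 'I_N -> R) : e \in Lfun mu 2%:E ->
  (forall psi, test_function psi -> \int[mu]_x (e x * psi x) = 0) ->
  (\int[mu]_x (e x * \1_(box l u) x)%:E)%E = 0%E.
Proof.
move=> eL e0.
have n0 (n : nat) (i : 'I_N) : 0 < (fun=> n.+1%:R : R) i by rewrite ltr0n.
pose psi n := bump l u (fun=> n.+1%:R) (fun=> n.+1%:R).
have me := Lfun2_measurable eL.
have mB : measurable_fun setT (\1_(box l u) : _ -> R).
  by apply: measurable_indic; exact: measurable_box.
have [] := @dominated_convergence _ _ _ mu setT measurableT
  (fun n x => (e x * psi n x)%:E) (fun x => (e x * \1_(box l u) x)%:E)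
  (fun x => `|(e x * \1_(box l u) x)%:E|%E).
- move=> n; apply/measurable_EFinP; apply: measurable_funM => //.
  by apply: measurable_bump.
- by apply/measurable_EFinP; apply: measurable_funM.
- apply: aeW => x _; apply: cvg_EFin; first by apply: nearW.
  have h : (e x * psi n x) @[n --> \oo] --> e x * \1_(box l u) x.
    by apply: cvgM; [exact: cvg_cst|exact: bump_cvg].
  exact: h.
- apply: integrable_abse; apply: Lfun2_mul_integrable => //; exact: indic_Lfun2.
- apply: aeW => x n _; rewrite !abse_EFin lee_fin !normrM ler_wpM2l//.
  by apply: le_trans (ler_norm _); exact: bump_le_indic.
move=> _ _ h; rewrite -(cvg_lim _ h)//; apply: lim_near_cst => //; apply: nearW => n /=.
have H := e0 _ (test_function_bump l u (n0 n) (n0 n)).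
rewrite -(@fineK _ (\int[mu]_x _)%E).
  exact: congr1 H.
apply: integrable_fin_num => //; apply: Lfun2_mul_integrable => //.
exact: bump_Lfun2.
Qed.

End L2.
(** * The fundamental lemma of the calculus of variations *)

Section density.
Context d (T : measurableType d) (R : realType) (mu : {measure set T -> \bar R}).
Variables (f : T -> \bar R) (mf : measurable_fun setT f) (f0 : forall x, (0 <= f x)%E).

(** The proofs are arguments of the definition so that its measure structure can
    be inferred for any function provided with them. *)
Definition density of measurable_fun setT f & (forall x, (0 <= f x)%E) :=
  fun A : set T => (\int[mu]_(x in A) f x)%E.

Let density0 : density mf f0 set0 = 0%E.
Proof. exact: integral_set0. Qed.

Let density_ge0 A : (0 <= density mf f0 A)%E.
Proof. exact: integral_ge0. Qed.

Let density_sigma_additive : semi_sigma_additive (density mf f0).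
Proof.
move=> F mF tF mUF; rewrite /density ge0_integral_bigcup//.
- by apply: is_cvg_nneseries => n _ _; exact: integral_ge0.
- exact: measurable_funTS.
Qed.

HB.instance Definition _ := isMeasure.Build _ _ _ (density mf f0)
  density0 density_ge0 density_sigma_additive.

End density.

Section fundamental_lemma.
Context (R : realType) (N : nat).
Local Notation mu := (leb R N).
Implicit Types (f g e : 'rV[R]_N -> R).

Lemma measurable_set_gt0 f : measurable_fun setT f -> measurable [set x | 0 < f x].
Proof.
move=> mf; rewrite -[X in measurable X]setTI.
have := mf measurableT `]0, +oo[%classic (measurable_itv _).
by congr measurable; apply/seteqP; split=> x /=; rewrite in_itv /= andbT.
Qed.

Lemma integral_pos_eq0 e : measurable_fun setT e ->
  (\int[mu]_(x in [set x | (0 < e x)%R]) (e x)%:E = 0)%E ->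
  {ae mu, forall x, e x <= 0}.
Proof.
move=> me e0; have mA := measurable_set_gt0 me.
have mEA : measurable_fun [set x | 0 < e x] (EFin \o e).
  by apply/measurable_EFinP; exact: measurable_funTS.
have [H _] := ae_eq_integral_abs mu mA mEA.
have /H : (\int[mu]_(x in [set x | (0 < e x)%R]) `|(EFin \o e) x| = 0)%E.
  rewrite -[RHS]e0; apply: eq_integral => x; rewrite inE /= => ex.
  by rewrite gtr0_norm.
apply: filterS => x /= h; rewrite leNgt; apply/negP => ex.
by have [/eqP] := h ex; rewrite gt_eqF.
Qed.

(** The positive and the negative part of [e] are densities of two measures that
    agree on boxes, hence everywhere. On the set where [e] is positive the second
    measure vanishes, so the first one does too; likewise where [e] is negative. *)
Lemma fundamental_lemma e : e \in Lfun mu 2%:E ->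
  (forall psi, test_function psi -> \int[mu]_x (e x * psi x) = 0) ->
  {ae mu, forall x, e x = 0}.
Proof.
move=> eL e0; have me := Lfun2_measurable eL.
have mE : measurable_fun setT (EFin \o e) by apply/measurable_EFinP.
pose m1 := density mu (measurable_funepos mE) (funepos_ge0 (EFin \o e)).
pose m2 := density mu (measurable_funeneg mE) (funeneg_ge0 (EFin \o e)).
have ib (l u : 'I_N -> R) : mu.-integrable (box l u) (EFin \o e).
  apply/integrable_mkcond; first exact: measurable_box.
  have := Lfun2_mul_integrable eL (indic_Lfun2 l u).
  apply: eq_integrable => // x _; rewrite patchE indicE.
  by case: ifP => _; rewrite ?mulr1 ?mulr0.
have fp l u : (\int[mu]_(x in box l u) (EFin \o e)^\+ x)%E \is a fin_num.
  by apply: integrable_fin_num (integrable_funepos (measurable_box l u) (ib l u));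
    exact: measurable_box.
have fn l u : (\int[mu]_(x in box l u) (EFin \o e)^\- x)%E \is a fin_num.
  by apply: integrable_fin_num (integrable_funeneg (measurable_box l u) (ib l u));
    exact: measurable_box.
have m12 A : measurable A -> m1 A = m2 A.
  apply: (@rV_measure_unique R N
    (density mu (measurable_funepos mE) (funepos_ge0 (EFin \o e)))
    (density mu (measurable_funeneg mE) (funeneg_ge0 (EFin \o e)))) => [l u|k].
    have := integral_box_eq0 l u eL e0.
    have -> : (\int[mu]_x (e x * \1_(box l u) x)%:E = \int[mu]_(x in box l u) (e x)%:E)%E.
      rewrite [RHS]integral_mkcond; apply: eq_integral => x _; rewrite patchE indicE.
      by case: ifP => _; rewrite ?mulr1 ?mulr0.
    rewrite integralE => h; rewrite /m1 /m2 /density.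
    by have := subeK (\int[mu]_(x in box l u) (EFin \o e)^\+ x) (fn l u); rewrite h add0e.
  by rewrite /m1 /density ltey_eq fp.
have e_le0 : {ae mu, forall x, e x <= 0}.
  apply: integral_pos_eq0 => //.
  rewrite (eq_integral ((EFin \o e)^\+)%E); last first.
    by move=> x; rewrite inE /= => ex; rewrite funeposE max_l// lee_fin ltW.
  have /= := m12 _ (measurable_set_gt0 me); rewrite /m1 /m2 /density => ->.
  apply: integral0_eq => x /= ex.
  by rewrite funenegE max_r// leeNl oppe0 lee_fin ltW.
have e_ge0 : {ae mu, forall x, (\- e) x <= 0}.
  have mN : measurable_fun setT (\- e) by exact: measurableT_comp.
  apply: integral_pos_eq0 => //.
  rewrite (eq_integral ((EFin \o e)^\-)%E); last first.
    by move=> x; rewrite inE /= => ex; rewrite funenegE max_l// lee_fin ltW.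
  have /= := m12 _ (measurable_set_gt0 mN); rewrite /m1 /m2 /density => <-.
  apply: integral0_eq => x /= ex.
  by rewrite funeposE max_r// lee_fin -oppr_ge0 ltW.
apply: filterS2 e_le0 e_ge0 => x; rewrite /= oppr_le0 => h1 h2.
by apply/eqP; rewrite eq_le h1 h2.
Qed.

End fundamental_lemma.
(** * Weak gradients and the Dirichlet integral *)

Section weak_gradient.
Context (R : realType) (N : nat).
Local Notation mu := (leb R N).
Implicit Types (u v psi : 'rV[R]_N -> R).

Lemma compact_sub_cube (K : set 'rV[R]_N) : compact K -> exists k, K `<=` cube N k.
Proof.
move=> /compact_bounded[M [_ MK]].
exists (Num.truncn (`|M| + 1)).+1 => x Kx i; rewrite -ltr_norml.
apply: le_lt_trans (norm_coord_le x i) _.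
apply: le_lt_trans (truncnS_gt (`|M| + 1)); apply: MK => //.
by rewrite ltr_pwDr// ler_norm.
Qed.

Lemma compact_support_Lfun2 psi : continuous psi ->
  compact (closure [set x | psi x != 0]) -> psi \in Lfun mu 2%:E.
Proof.
move=> cpsi cK; have [k Kk] := compact_sub_cube cK.
have cc : {within closure [set x | psi x != 0], continuous psi}.
  exact: continuous_subspaceT.
have [M [_ Mpsi]] := compact_bounded (continuous_compact cc cK).
have iL : (`|M| + 1) \o* (\1_(cube N k) : 'rV[R]_N -> R) \in Lfun mu 2%:E.
  by apply: Lfun_scale; [rewrite ler1n|exact: indic_Lfun2].
apply: Lfun2_le iL; first exact: continuous_rV_measurable.
move=> x; have [->|nz] := eqVneq (psi x) 0; first by rewrite normr0.
have Kx : closure [set x | psi x != 0] x by exact: subset_closure.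
rewrite /= indicE mem_set ?mulr1 ?mul1r; last exact: Kk.
apply: le_trans (ler_norm _); apply: Mpsi; last by exists x.
by rewrite ltr_pwDr// ler_norm.
Qed.

Lemma test_function_Lfun2 psi : test_function psi -> psi \in Lfun mu 2%:E.
Proof. by move=> [/(_ 0%N)/Cn_continuous cpsi]; exact: compact_support_Lfun2. Qed.

Lemma partial_Lfun2 psi i : test_function psi -> partial i psi \in Lfun mu 2%:E.
Proof.
move=> [tpsi cK]; apply: compact_support_Lfun2.
  by have [_ /(_ i)[_ [cp _]]] := tpsi 1%N.
apply: compact_support cK _ => x; apply: contra_neqP => nx.
rewrite /partial (@near_eq_derive _ _ _ _ (cst (0 : R))) ?derive_cst//.
have : nbhs x (~` closure [set x | psi x != 0]).
  by apply: open_nbhs_nbhs; split => //; rewrite openC; exact: closed_closure.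
apply: filterS => y ny; apply/eqP; apply: contrapT => /negP py.
by apply: ny; exact: subset_closure.
Qed.

Lemma weak_gradP u : H1 u -> is_weak_grad u (weak_grad u).
Proof. by move=> [_ [d ud]]; exact: (xgetPex _ (ex_intro _ d ud)). Qed.

Lemma weak_grad_unique u d1 d2 i : is_weak_grad u d1 -> is_weak_grad u d2 ->
  {ae mu, forall x, d1 x ord0 i = d2 x ord0 i}.
Proof.
move=> /(_ i)[L1 E1] /(_ i)[L2 E2].
have : {ae mu, forall x, d1 x ord0 i - d2 x ord0 i = 0}.
  apply: fundamental_lemma.
    have p1 : (1 <= 2%:E :> \bar R)%E by rewrite lee_fin ler1n.
    have [_ /(_ (-1) _ _ L2 L1)] := Lfun_submod_closed mu p1.
    rewrite (_ : _ + _ = fun x => d1 x ord0 i - d2 x ord0 i)//.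
    by apply/funext => x; rewrite addrC; congr (_ + _); exact: mulN1r.
  move=> psi tpsi; have pL := test_function_Lfun2 tpsi.
  under eq_Rintegral do rewrite mulrBl.
  rewrite RintegralB//; [|exact: Lfun2_mul_integrable..].
  by apply/eqP; rewrite subr_eq0 -eqr_opp -E1// -E2.
by apply: filterS => x /eqP; rewrite subr_eq0 => /eqP.
Qed.

Lemma Rintegral_ae_eq u v : measurable_fun setT u -> measurable_fun setT v ->
  {ae mu, forall x, u x = v x} -> \int[mu]_x u x = \int[mu]_x v x.
Proof.
move=> mu1 mv1 uv; rewrite /Rintegral; congr fine; apply: ae_eq_integral => //.
- exact/measurable_EFinP.
- exact/measurable_EFinP.
- by apply: filterS uv => x -> _.
Qed.

(** The chosen gradient may be replaced by any other one; this makes the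
    Dirichlet integral computable. *)
Lemma dirichletE u d : H1 u -> is_weak_grad u d ->
  dirichlet u = \int[mu]_x (\sum_i d x ord0 i ^+ 2).
Proof.
move=> H1u ud; have uw := weak_gradP H1u.
have ms d' : is_weak_grad u d' -> measurable_fun setT (fun x => \sum_i d' x ord0 i ^+ 2).
  move=> h; apply: measurable_sum => i; apply: measurable_funX.
  by have [/Lfun2_measurable] := h i.
apply: Rintegral_ae_eq; [exact: ms|exact: ms|].
have : {ae mu, forall x, forall i, weak_grad u x ord0 i = d x ord0 i}.
  by apply: filter_forall => i; exact: weak_grad_unique.
by apply: filterS => x h; apply: eq_bigr => i _; rewrite h.
Qed.

Lemma dirichlet_ge0 u : 0 <= dirichlet u.
Proof. by apply: Rintegral_ge0 => x _; apply: sumr_ge0 => i _; exact: sqr_ge0. Qed.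

Lemma dirichlet_eq0 u : H1 u -> dirichlet u = 0 ->
  forall i, {ae mu, forall x, weak_grad u x ord0 i = 0}.
Proof.
move=> H1u u0 i; have uw := weak_gradP H1u.
have iF : mu.-integrable setT (fun x => (\sum_i weak_grad u x ord0 i ^+ 2)%:E).
  under eq_fun do rewrite -sumEFin.
  apply: integrable_sum => // j _.
  by have [/Lfun2P[_]] := uw j.
have : (\int[mu]_x `|(\sum_i weak_grad u x ord0 i ^+ 2)%:E| = 0)%E.
  rewrite -(@fineK _ (\int[mu]_x _)%E); last first.
    by apply: integrable_fin_num => //; exact: integrable_abse.
  rewrite -[RHS](congr1 EFin u0) /dirichlet /Rintegral; congr (fine _)%:E.
  apply: eq_integral => x _; rewrite gee0_abs// lee_fin.
  by apply: sumr_ge0 => j _; exact: sqr_ge0.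
move/(ae_eq_integral_abs mu measurableT (measurable_int _ iF)).
apply: filterS => x /= /(_ I)[/eqP].
rewrite psumr_eq0 => [|j _]; last exact: sqr_ge0.
by move=> /allP/(_ i (mem_index_enum _)); rewrite sqrf_eq0 => /eqP.
Qed.

End weak_gradient.
(** * Positivity of the Dirichlet integral *)

Section no_constant.
Context (R : realType) (n : nat).
Local Notation N := n.+1.
Local Notation mu := (leb R N).
Local Notation i0 := (ord0 : 'I_N).
Implicit Types (v psi : 'rV[R]_N -> R).

Lemma flat0_ge (t : R) : 2^-1 <= t -> expR (- 2) <= flat 0 t.
Proof.
move=> h; have t0 : 0 < t by apply: lt_le_trans h; rewrite invr_gt0.
rewrite /flat t0 expr0 mul1r ler_expR lerN2.
by rewrite -[leRHS]invrK lef_pV2// posrE// invr_gt0.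
Qed.

Lemma flat2_ge (t : R) : 1 <= t <= 2 -> 4^-1 * expR (- 2) <= flat 2 t.
Proof.
move=> /andP[h1 h2]; have t0 : 0 < t by apply: lt_le_trans h1.
have : expR (- 2) <= flat 0 t.
  by apply: flat0_ge; apply: le_trans h1; rewrite invf_le1// ler1n.
rewrite /flat t0 expr0 mul1r => h; apply: ler_pM; rewrite ?expR_ge0//.
rewrite exprVn lef_pV2 ?posrE ?exprn_gt0// (_ : 4 = 2 ^+ 2 :> R); last by ring.
by rewrite ler_pXn2r ?nnegrE// ltW.
Qed.

(** The slab has length [w] along the first axis and side 4 in the other
    directions; its bump rises steeply near 0 and decreases over a length [w]. *)
Definition slab_u (w : R) (i : 'I_N) : R := if i == i0 then w else 4.
Definition slab_d (w : R) (i : 'I_N) : R := if i == i0 then w^-1 else 1.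
Definition slab w := box (fun=> 0 : R) (slab_u w).
Definition slab_bump w := bump (fun=> 0 : R) (slab_u w) (fun=> 1) (slab_d w).
Definition ucube := box (fun _ : 'I_N => 1 : R) (fun=> 2).

Lemma slab_d_gt0 w i : 0 < w -> 0 < slab_d w i.
Proof. by move=> w0; rewrite /slab_d; case: ifP; rewrite ?invr_gt0. Qed.

(** The rising side contributes a positive amount on the fixed cube, whatever
    [w >= 4]; the decreasing side contributes at most [2 / w] in absolute value,
    2 being the bound [2`!] of [flat 2]. *)
Lemma partial_slab_bump_ge (w : R) x : 4 <= w ->
  4^-1 * expR (- 2) * expR (- 2) * (expR (- 2) * expR (- 2)) ^+ n * \1_ucube x
  - 2 / w * \1_(slab w) x <= partial i0 (slab_bump w) x.
Proof.
move=> w4; have w0 : 0 < w by apply: lt_le_trans w4; rewrite ltr0n.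
have d0 i : 0 < slab_d w i by exact: slab_d_gt0.
rewrite partial_bump /slab_d /slab_u eqxx !mul1r !subr0.
set P := \prod_(j | _) _.
have P0 : 0 <= P by apply: prodr_ge0 => i _; rewrite mulr_ge0// flat_ge0.
have P1 : P <= 1.
  rewrite /P -[leRHS](@big1_eq _ 1 *%R _ (index_enum 'I_N) (fun j => j != i0)).
  apply: ler_prod => i _; rewrite mulr_ge0 ?flat_ge0//=.
  by rewrite mulr_ile1 ?flat_ge0 ?flat0_le1.
rewrite mulrBl lerB//.
- rewrite indicE; have [Qx|nQx] := pselect (ucube x); last first.
    by rewrite memNset// mulr0 !mulr_ge0 ?flat_ge0.
  rewrite mem_set// mulr1.
  have h i : 1 <= x ord0 i <= 2 by have /andP[/ltW -> /ltW ->] := Qx i.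
  apply: ler_pM; rewrite ?mulr_ge0 ?exprn_ge0 ?expR_ge0//.
    apply: ler_pM; rewrite ?mulr_ge0 ?expR_ge0 ?flat2_ge// flat0_ge//.
    have /andP[_ h2] := h i0.
    rewrite ler_pdivlMl//; lra.
  rewrite /P.
  have -> : (expR (- 2) * expR (- 2)) ^+ n =
     \prod_(j : 'I_N | j != i0) (expR (- 2) * expR (- 2)) :> R.
    by rewrite prodr_const cardC1 card_ord.
  apply: ler_prod => j ji; rewrite mulr_ge0 ?expR_ge0//=.
  have /andP[h1 h2] := h j.
  rewrite (negbTE ji) !mul1r subr0.
  by apply: ler_pM; rewrite ?expR_ge0// flat0_ge//; lra.
- set A := flat 0 _; set B := flat 2 _.
  have -> : w^-1 * A * B * P = w^-1 * (A * B * P) by ring.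
  have -> : 2 / w * \1_(slab w) x = w^-1 * (\1_(slab w) x * 2) by ring.
  rewrite ler_wpM2l//; first by rewrite invr_ge0 ltW.
  have A0 : 0 <= A by exact: flat_ge0.
  have B0 : 0 <= B by exact: flat_ge0.
  have [Sx|/existsNP[i /negP]] := pselect (slab w x).
    rewrite indicE mem_set// mul1r.
    have A1 : A <= 1 by exact: flat0_le1.
    have B2 : B <= 2 by exact: flat_bounded.
    rewrite -[leRHS]mulr1.
    apply: ler_pM => //; first exact: mulr_ge0.
    by rewrite -[leRHS]mul1r; exact: ler_pM.
  rewrite negb_and -!leNgt => h; rewrite [X in X <= _](_ : _ = 0).
    by rewrite mulr_ge0.
  have [ii0|ii0] := eqVneq i i0.
    move: h; rewrite ii0 /slab_u eqxx /A /B => /orP[h|h].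
      by rewrite flat_le0 ?mul1r// !mul0r.
    rewrite (@flat_le0 _ 2) ?mulr0 ?mul0r// pmulr_rle0 ?invr_gt0// subr_le0.
    exact: h.
  rewrite /P (bigD1 i)//= (negbTE ii0) !mul1r subr0.
  move: h; rewrite /slab_u (negbTE ii0) => /orP[h|h].
    by rewrite (flat_le0 0 h) !(mul0r, mulr0).
  by rewrite (@flat_le0 _ 0 (4 - _)) ?subr_le0// !(mul0r, mulr0).
Qed.

(** Let [c] be the integral of [v] over the cube. Testing with the slab bumps
    bounds [kappa c] by [2 / w] times the integral of [v] over the slab. Since
    [v <= d v^2 + 1 / d] and the slab has volume [w 4^n], this is at most
    [2 d E / w + 2 4^n / d], where [E] is the integral of [v^2]. Choosing first
    [d] and then [w] large makes it smaller than [kappa c], unless [c = 0]. *)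
Lemma partial_eq0_ucube v : v \in Lfun mu 2%:E -> (forall x, 0 <= v x) ->
  (forall psi, test_function psi -> \int[mu]_x (v x * partial i0 psi x) = 0) ->
  \int[mu]_x (v x * \1_ucube x) = 0.
Proof.
move=> vL v0 dv.
pose E := \int[mu]_x (v x ^+ 2).
have mv := Lfun2_measurable vL.
have iQ : mu.-integrable setT (fun x => (v x * \1_ucube x)%:E).
  by apply: Lfun2_mul_integrable => //; exact: indic_Lfun2.
have iS w : mu.-integrable setT (fun x => (v x * \1_(slab w) x)%:E).
  by apply: Lfun2_mul_integrable => //; exact: indic_Lfun2.
have iv : mu.-integrable setT (fun x => (v x ^+ 2)%:E) by have /Lfun2P[] := vL.
have i1 w : mu.-integrable setT (fun x => (\1_(slab w) x : R)%:E).
  have /Lfun2P[_] := indic_Lfun2 (fun=> 0 : R) (slab_u w).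
  apply: eq_integrable => // x _; rewrite indicE.
  by case: (_ \in _); rewrite ?expr1n ?expr0n.
have iZ (k : R) f : mu.-integrable setT (EFin \o f) ->
    mu.-integrable setT (fun x : 'rV[R]_N => (k * f x)%:E).
  by move=> fi; under eq_fun do rewrite EFinM; exact: integrableZl.
pose kappa : R := 4^-1 * expR (- 2) * expR (- 2) * (expR (- 2) * expR (- 2)) ^+ n.
have k0 : 0 < kappa by rewrite !mulr_gt0 ?exprn_gt0 ?mulr_gt0 ?expR_gt0 ?invr_gt0.
pose c := \int[mu]_x (v x * \1_ucube x).
have c0 : 0 <= c by apply: Rintegral_ge0 => x _; rewrite mulr_ge0// indicE.
have step1 w : 4 <= w -> kappa * c <= 2 / w * \int[mu]_x (v x * \1_(slab w) x).
  move=> w4.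
  have w0 : 0 < w by apply: lt_le_trans w4; rewrite ltr0n.
  have tb : test_function (slab_bump w).
    by apply: test_function_bump => // i; exact: slab_d_gt0.
  rewrite -subr_le0 -[leRHS](dv _ tb) /c -(RintegralZl kappa measurableT iQ)
    -(RintegralZl (2 / w) measurableT (iS w)) -RintegralB//;
    [|exact: (iZ kappa _ iQ)|exact: (iZ (2 / w) _ (iS w))].
  apply: le_Rintegral => //.
  - exact: (integrableB measurableT (iZ kappa _ iQ) (iZ (2 / w) _ (iS w))).
  - by apply: Lfun2_mul_integrable => //; exact: partial_Lfun2.
  - move=> x _; rewrite mulrCA [X in _ - X]mulrCA -mulrBr ler_wpM2l//.
    exact: partial_slab_bump_ge.
have step2 w (d : R) : 0 < d -> \int[mu]_x (v x * \1_(slab w) x) <=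
   d * E + d^-1 * \int[mu]_x (\1_(slab w) x).
  move=> d0; rewrite -(RintegralZl d measurableT iv) -(RintegralZl d^-1 measurableT (i1 w)).
  rewrite -RintegralD//; [|exact: (iZ d _ iv)|exact: (iZ d^-1 _ (i1 w))].
  apply: le_Rintegral => //.
    exact: iS.
    exact: (integrableD measurableT (iZ d _ iv) (iZ d^-1 _ (i1 w))).
  move=> x _; rewrite indicE; case: (_ \in _); last first.
    by rewrite !mulr0 addr0 mulr_ge0 ?sqr_ge0// ltW.
  rewrite !mulr1 -subr_ge0.
  have -> : d * v x ^+ 2 + d^-1 - v x =
      d * ((v x - (2 * d)^-1) ^+ 2) + 3 / 4 * d^-1.
    by field; rewrite gt_eqF.
  by rewrite addr_ge0// mulr_ge0 ?sqr_ge0 ?invr_ge0 ?(ltW d0)// divr_ge0.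
have step3 w : 4 <= w -> \int[mu]_x (\1_(slab w) x) = w * 4 ^+ n.
  move=> w4; rewrite /Rintegral integral_indic//; last exact: measurable_box.
  rewrite setIT [X in fine X](leb_box (fun=> 0) (slab_u w)) /= big_ord_recl; congr (_ * _).
    rewrite /slab_u eqxx subr0 max_r//; lra.
  rewrite -[X in _ ^+ X](card_ord n) -prodr_const; apply: eq_bigr => i _.
  by rewrite /slab_u /= subr0 max_r.
apply/eqP; rewrite -/c eq_le c0 andbT leNgt; apply/negP => c_gt0.
have E0 : 0 <= E by apply: Rintegral_ge0 => x _; exact: sqr_ge0.
have V0 : 0 < 4 ^+ n :> R by rewrite exprn_gt0.
pose V : R := 4 ^+ n.
pose q := kappa * c; have q0 : 0 < q by exact: mulr_gt0.
(* These values make each of the two error terms equal to at most [q / 4]. *)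
pose d := 8 * V / q; have d0 : 0 < d by rewrite divr_gt0// mulr_gt0.
pose w := 4 + 8 * d * E / q.
have w4 : 4 <= w by rewrite lerDl; apply: divr_ge0 (ltW q0); apply: mulr_ge0 E0; rewrite mulr_ge0// ltW.
have w0 : 0 < w by lra.
have := step1 w w4; rewrite -/q.
have : 2 / w * \int[mu]_x (v x * \1_(slab w) x) <=
   2 / w * (d * E + d^-1 * (w * V)).
  apply: ler_wpM2l; first by rewrite divr_ge0// ltW.
  by rewrite /V -step3//; exact: step2.
have -> : 2 / w * (d * E + d^-1 * (w * V)) = 2 * d * E / w + q / 4.
  by rewrite /d; field; rewrite !gt_eqF.
have : 2 * d * E / w <= q / 4.
  rewrite ler_pdivrMr//.
  have -> : q / 4 * w = q + 2 * d * E by rewrite /w; field; rewrite gt_eqF.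
  by rewrite lerDr ltW.
lra.
Qed.

(** If the gradient vanished, [partial_eq0_ucube] applied to the absolute value,
    which is nonnegative everywhere and not just almost everywhere, would make
    the integral of [v] over a cube zero. *)
Lemma H1_gt0_dirichlet v : H1 v -> {ae mu, forall x, 0 < v x} -> 0 < dirichlet v.
Proof.
move=> H1v v_gt0; rewrite lt_neqAle dirichlet_ge0 andbT eq_sym; apply/eqP => dv.
have [vL _] := H1v; have mv := Lfun2_measurable vL.
have nL : (fun x => `|v x|) \in Lfun mu 2%:E.
  by apply: Lfun2_le vL => [|x]; [exact: measurableT_comp|rewrite normr_id].
have nv : {ae mu, forall x, `|v x| = v x}.
  by apply: filterS v_gt0 => x; exact: gtr0_norm.
have Q0 : \int[mu]_x (`|v x| * \1_ucube x) = 0.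
  apply: partial_eq0_ucube => // psi tpsi.
  have mp := partial_measurable i0 tpsi.
  rewrite (@Rintegral_ae_eq _ _ _ (fun x => v x * partial i0 psi x)).
  - have [dL ->//] := weak_gradP H1v i0.
    apply/eqP; rewrite oppr_eq0; apply/eqP.
    rewrite (@Rintegral_ae_eq _ _ _ (cst 0)).
    + by rewrite /Rintegral integral0.
    + apply: measurable_funM; first exact: Lfun2_measurable.
      exact: test_function_measurable.
    + exact: measurable_cst.
    + by apply: filterS (dirichlet_eq0 H1v dv i0) => x ->; rewrite mul0r.
  - by apply: measurable_funM => //; exact: Lfun2_measurable.
  - exact: measurable_funM.
  - by apply: filterS nv => x ->.
have iQ : mu.-integrable setT (fun x => (`|v x| * \1_ucube x)%:E).
  by apply: Lfun2_mul_integrable => //; exact: indic_Lfun2.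
have : (\int[mu]_x `|(`|v x| * \1_ucube x)%:E| = 0)%E.
  rewrite -(@fineK _ (\int[mu]_x _)%E); last first.
    by apply: integrable_fin_num => //; exact: integrable_abse.
  rewrite -[RHS](congr1 EFin Q0) /Rintegral; congr (fine _)%:E.
  by apply: eq_integral => x _; rewrite gee0_abs// lee_fin mulr_ge0// indicE.
move/(ae_eq_integral_abs mu measurableT (measurable_int _ iQ)) => h.
have : {ae mu, forall x, ~ ucube x}.
  apply: filterS2 v_gt0 h => x vx /= /(_ I)[/eqP + Qx].
  by rewrite indicE mem_set// mulr1 normr_eq0 gt_eqF.
move=> [A [mA A0 QA]].
have : (mu ucube <= mu A)%E.
  apply: le_measure; rewrite ?inE//; first exact: measurable_box.
  by move=> x Qx; apply: QA => /=; apply.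
rewrite A0 leNgt => /negP; apply.
by rewrite [X in (_ < X)%E](leb_box (fun=> 1) (fun=> 2)) lte_fin prodr_gt0// => i _;
  rewrite lt_max; apply/orP; right; lra.
Qed.

End no_constant.
(** * Dilating solutions *)

Section primitive_measurable.
Context (R : realType).
Implicit Types g : R -> R.
Local Notation leb1 := (@lebesgue_measure R).

Lemma measurable_integral0 g : continuous g ->
  measurable_fun setT (fun t : R => \int[leb1]_(s in `[0, t]) g s).
Proof.
move=> cg.
have -> : [set: R] = \bigcup_k (`]-oo, 0[%classic `|` `[0, k%:R]%classic).
  apply/seteqP; split => // t _; exists (Num.truncn `|t|).+1 => //=.
  rewrite !in_itv /=; have [t0|t0] := ltP t 0; first by left.
  by right; rewrite -[t in t <= _]ger0_norm// ltW// truncnS_gt.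
apply/measurable_fun_bigcup => k; first exact: measurableU.
apply/measurable_funU => //; split.
  apply: (eq_measurable_fun (cst (0 : R))); last exact: measurable_cst.
  move=> t; rewrite inE /= in_itv /= => t0.
  by rewrite set_itv_ge ?Rintegral_set0// bnd_simp -ltNge.
apply: subspace_continuous_measurable_fun => //.
apply: parameterized_integral_continuous => //.
by apply: continuous_compact_integrable; [exact: segment_compact|exact: continuous_subspaceT].
Qed.

Lemma measurable_primitive g : continuous g -> measurable_fun setT (primitive g).
Proof.
move=> cg.
have cgN : continuous (g \o -%R).
  by move=> x; apply: continuous_comp; [exact: opp_continuous|exact: cg].
have -> : primitive g = fun t => if 0 <= t then \int[leb1]_(s in `[0, t]) g s
   else - \int[leb1]_(s in `[0, - t]) (g \o -%R) s.
  apply/funext => t; rewrite /primitive; case: ifPn => //; rewrite -ltNge => t0.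
  congr (- fine _); have := @integration_by_substitution_oppr R g 0 (- t).
  rewrite oppr0 opprK; apply; first by rewrite oppr_ge0 ltW.
  exact: continuous_subspaceT.
apply: measurable_fun_ifT.
- exact: measurable_fun_ler.
- exact: measurable_integral0.
- apply: measurableT_comp => //.
  by apply: (measurableT_comp (measurable_integral0 cgN)).
Qed.

End primitive_measurable.

Section dilation.
Context (R : realType) (N : nat).
Local Notation mu := (leb R N).
Implicit Types (u psi : 'rV[R]_N -> R) (d : 'rV[R]_N -> 'rV[R]_N).
Variables (s : R) (s0 : 0 < s).

Let sN0 : 0 < (s ^+ N)^-1. Proof. by rewrite invr_gt0 exprn_gt0. Qed.

Lemma Lfun2_dilate u : u \in Lfun mu 2%:E -> (fun x => u (s *: x)) \in Lfun mu 2%:E.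
Proof.
move=> /Lfun2P[mu2 /integrableP[mu3 iu]]; apply/Lfun2P.
have m1 : measurable_fun setT (fun x : 'rV[R]_N => u (s *: x)).
  exact: (measurableT_comp mu2 (measurable_scale s)).
split=> //; apply/integrableP; split.
  by apply/measurable_EFinP; exact: measurable_funX.
rewrite (@integral_dilate _ _ s (fun x => `|(u x ^+ 2)%:E|)%E)//.
  by rewrite lte_mul_pinfty// lee_fin ltW.
exact: measurableT_comp.
Qed.

(** Writes the derivative of [psi] as a dilated function, so that
    [Rintegral_dilate] applies to integrals against it. *)
Lemma partial_dilateK psi i : test_function psi ->
  partial i psi = fun x => s * partial i (fun y : 'rV[R]_N => psi (s^-1 *: y)) (s *: x).
Proof.
move=> [/(_ 1%N) c1 _]; rewrite (partial_dilate s^-1 i c1); apply/funext => x.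
by rewrite scalerA mulrA mulfV ?gt_eqF// mul1r mulVf ?gt_eqF// scale1r.
Qed.

(** Substituting [y = s x] moves the dilation onto the test function. *)
Lemma is_weak_grad_dilate u d : u \in Lfun mu 2%:E -> is_weak_grad u d ->
  is_weak_grad (fun x => u (s *: x)) (fun x => s *: d (s *: x)).
Proof.
move=> uL ud i; have [dL E] := ud i; split.
  rewrite (_ : (fun x => _) = s \o* (fun x => d (s *: x) ord0 i)).
    by apply: Lfun_scale; [rewrite ler1n|exact: (Lfun2_dilate dL)].
  by apply/funext => x; rewrite mxE mulrC.
move=> psi tpsi.
pose psi' (y : 'rV[R]_N) := psi (s^-1 *: y).
have tpsi' : test_function psi' by apply: test_function_dilate => //; rewrite invr_eq0 gt_eqF.
have mu1 := Lfun2_measurable uL; have md := Lfun2_measurable dL.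
have mp := partial_measurable i tpsi'.
have mp' := test_function_measurable tpsi'.
have -> : \int[mu]_x (u (s *: x) * partial i psi x) =
    \int[mu]_x (fun y => s * (u y * partial i psi' y)) (s *: x).
  by apply: eq_Rintegral => x _; rewrite (partial_dilateK i tpsi) mulrCA.
have -> : \int[mu]_x ((s *: d (s *: x)) ord0 i * psi x) =
    \int[mu]_x (fun y => s * (d y ord0 i * psi' y)) (s *: x).
  apply: eq_Rintegral => x _; rewrite mxE /psi' scalerA mulVf ?gt_eqF// scale1r.
  by rewrite mulrA.
rewrite (@Rintegral_dilate _ _ s (fun y => s * (u y * partial i psi' y)))//; last first.
  by apply: measurable_funM => //; exact: measurable_funM.
rewrite (@Rintegral_dilate _ _ s (fun y => s * (d y ord0 i * psi' y)))//; last first.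
  by apply: measurable_funM => //; exact: measurable_funM.
rewrite !RintegralZ_gt0//; [|exact: measurable_funM..].
by rewrite E// !mulrN.
Qed.

Lemma H1_dilate u : H1 u -> H1 (fun x => u (s *: x)).
Proof.
move=> [uL [d ud]]; split; first exact: Lfun2_dilate.
by exists (fun x => s *: d (s *: x)); exact: is_weak_grad_dilate.
Qed.

Lemma dirichlet_dilate u : H1 u ->
  dirichlet (fun x => u (s *: x)) = s ^+ 2 / s ^+ N * dirichlet u.
Proof.
move=> H1u; have [uL _] := H1u; have uw := weak_gradP H1u.
rewrite (dirichletE (H1_dilate H1u) (is_weak_grad_dilate uL uw)).
have mF : measurable_fun setT (fun x : 'rV[R]_N => \sum_i weak_grad u x ord0 i ^+ 2).
  apply: measurable_sum => i; apply: measurable_funX.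
  by have [/Lfun2_measurable] := uw i.
rewrite (_ : \int[mu]_x _ = \int[mu]_x (fun y => s ^+ 2 * \sum_i weak_grad u y ord0 i ^+ 2) (s *: x)).
  rewrite (@Rintegral_dilate _ _ s (fun y => s ^+ 2 * \sum_i weak_grad u y ord0 i ^+ 2))//.
    by rewrite RintegralZ_gt0// ?exprn_gt0// /dirichlet; ring.
  exact: measurable_funM.
apply: eq_Rintegral => x _; rewrite mulr_sumr; apply: eq_bigr => i _.
by rewrite mxE exprMn.
Qed.

Variable g : R -> R.
Hypothesis cg : continuous g.

Lemma potential_dilate u : measurable_fun setT u ->
  potential g (fun x => u (s *: x)) = ((s ^+ N)^-1%:E * potential g u)%E.
Proof.
move=> mu1; rewrite /potential.
rewrite (@integral_dilate _ _ s (fun x => (primitive g (u x))%:E))//.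
apply/measurable_EFinP; exact: (measurableT_comp (measurable_primitive cg)).
Qed.

Lemma fine_potential_dilate u : measurable_fun setT u ->
  fine (potential g (fun x => u (s *: x))) = (s ^+ N)^-1 * fine (potential g u).
Proof.
move=> mu1; rewrite potential_dilate//.
case: (potential g u) => [r| |] //=.
- by rewrite gt0_muley ?lte_fin//= mulr0.
- by rewrite gt0_muleNy ?lte_fin//= mulr0.
Qed.

Lemma D_G_dilate u : D_G g u -> D_G g (fun x => u (s *: x)).
Proof.
move=> [H1u unz fu]; have [uL _] := H1u; split; first exact: H1_dilate.
- move=> /(@ae_dilate R N s^-1 _ _); rewrite invr_gt0 => /(_ s0) h; apply: unz.
  by apply: filterS h => x; rewrite scalerA mulfV ?gt_eqF// scale1r.
- by rewrite potential_dilate ?fin_numM//; exact: Lfun2_measurable.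
Qed.

Lemma locally_integrable_dilate (f : 'rV[R]_N -> R) : measurable_fun setT f ->
  locally_integrable_rV f -> locally_integrable_rV (fun x => f (s *: x)).
Proof.
move=> mf lf K cK.
have cl (A : set 'rV[R]_N) : compact A -> measurable A.
  move=> cA; rewrite -[A]setCK; apply: measurableC; apply: open_rV_measurable.
  by apply: closed_openC; apply: compact_closed => //; exact: norm_hausdorff.
pose L := (fun y : 'rV[R]_N => s *: y) @` K.
have cL : compact L.
  by apply: continuous_compact => //; apply: continuous_subspaceT; exact: scaler_continuous.
have KL x : K x <-> L (s *: x).
  split=> [Kx|[y Ky] /(congr1 ( *:%R s^-1))]; first by exists x.
  by rewrite !scalerA mulVf ?gt_eqF// !scale1r => <-.
have /integrableP[_ iL] := lf L cL.
apply/integrableP; split.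
  apply/measurable_EFinP; apply: measurable_funTS.
  exact: (measurableT_comp mf (measurable_scale s)).
rewrite integral_mkcond.
rewrite (_ : (\int[mu]_x _)%E =
   (\int[mu]_x ((fun y => `|(f y)%:E|) \_ L) (s *: x))%E); last first.
  apply: eq_integral => x _; rewrite !patchE; congr (if _ then _ else _).
  by apply/idP/idP; rewrite !inE => /KL.
rewrite integral_dilate//; last first.
  apply/(measurable_restrictT _ (cl _ cL)); apply: measurable_funTS.
  by apply: measurableT_comp => //; exact/measurable_EFinP.
by rewrite -integral_mkcond lte_mul_pinfty// lee_fin ltW.
Qed.

(** One factor [s] comes from the gradient of the solution and one from the
    gradient of the test function; the volume factor is common to both sides. *)
Lemma weak_solution_dilate (c : R) u : H1 u -> weak_solution g c u ->
  weak_solution g (c / s ^+ 2) (fun x => u (s *: x)).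
Proof.
move=> H1u [lu wu]; have [uL _] := H1u; have mu1 := Lfun2_measurable uL.
have mgu : measurable_fun setT (g \o u).
  by apply: (measurableT_comp (continuous_measurable_fun cg) mu1).
split; first exact: (locally_integrable_dilate mgu lu).
move=> psi tpsi.
pose psi' (y : 'rV[R]_N) := psi (s^-1 *: y).
have tpsi' : test_function psi' by apply: test_function_dilate => //; rewrite invr_eq0 gt_eqF.
have uw := weak_gradP H1u.
have uw' := weak_gradP (H1_dilate H1u).
have md i : measurable_fun setT (fun x => weak_grad u x ord0 i).
  by have [/Lfun2_measurable] := uw i.
have E : {ae mu, forall x, forall i, weak_grad (fun x => u (s *: x)) x ord0 i =
     (s *: weak_grad u (s *: x)) ord0 i}.
  apply: filter_forall => i; apply: (weak_grad_unique i uw').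
  exact: is_weak_grad_dilate.
pose F (y : 'rV[R]_N) := \sum_i weak_grad u y ord0 i * partial i psi' y.
have mF : measurable_fun setT F.
  by apply: measurable_sum => i; apply: measurable_funM => //; exact: partial_measurable.
rewrite (@Rintegral_ae_eq _ _ _ (fun x => (fun y => s ^+ 2 * F y) (s *: x))); last first.
- apply: filterS E => x Ex; rewrite mulr_sumr; apply: eq_bigr => i _.
  rewrite Ex mxE (partial_dilateK i tpsi); ring.
- apply: (measurableT_comp (_ : measurable_fun setT (fun y => s ^+ 2 * F y)) (measurable_scale s)).
  exact: measurable_funM.
- apply: measurable_sum => i; apply: measurable_funM; last exact: partial_measurable.
  by have [/Lfun2_measurable] := uw' i.
rewrite (@Rintegral_dilate _ _ s (fun y => s ^+ 2 * F y))//; last exact: measurable_funM.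
rewrite RintegralZ_gt0 ?exprn_gt0//.
have -> : \int[mu]_x (g (u (s *: x)) * psi x) =
    \int[mu]_x (fun y => g (u y) * psi' y) (s *: x).
  by apply: eq_Rintegral => x _; rewrite /psi' scalerA mulVf ?gt_eqF// scale1r.
rewrite (@Rintegral_dilate _ _ s (fun y => g (u y) * psi' y))//; last first.
  by apply: measurable_funM => //; exact: test_function_measurable.
rewrite -(wu psi' tpsi') /F.
by field; rewrite ?expf_neq0 gt_eqF.
Qed.

End dilation.
(** * Solutions of the Kirchhoff problem and branches *)

Section correspondence.
Context (R : realType) (N : nat) (g : R -> R) (a theta : R).
Hypotheses (N3 : (3 <= N)%N) (a0 : 0 < a) (theta0 : 0 < theta) (cg : continuous g).
Implicit Types (u phi : 'rV[R]_N -> R) (s t b : R).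

Lemma s_rangeP s : s_range a s <-> 0 < s /\ a * s ^+ 2 <= 1.
Proof.
have E : a `^ (- 2^-1) = (Num.sqrt a)^-1 by rewrite powRN powR12_sqrt// ltW.
have sa : 0 < Num.sqrt a by rewrite sqrtr_gt0.
have q : 0 < s -> (s <= (Num.sqrt a)^-1) = (a * s ^+ 2 <= 1).
  move=> s0; rewrite -[in RHS](sqr_sqrtr (ltW a0)) -exprMn -[X in _ = (_ <= X)](expr1n _ 2).
  rewrite ler_pXn2r ?nnegrE ?mulr_ge0 ?(ltW s0) ?(ltW sa)//.
  by rewrite -ler_pdivlMl// mulr1.
rewrite /s_range /= in_itv /= E; split=> [/andP[s0]|[s0]]; first by rewrite q.
by rewrite s0 q.
Qed.

(** The Pohozaev identity expresses the potential through the Dirichlet integral. *)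
Lemma action_P phi : P_set N g phi -> action g phi = dirichlet phi / N%:R.
Proof.
move=> [_ _ E]; rewrite /action.
have N0 : (N%:R : R) != 0 by rewrite pnatr_eq0; case: (N) N3.
have -> : fine (potential g phi) = (N%:R - 2) / 2 * dirichlet phi / N%:R.
  by rewrite E mulrC mulKf.
by field.
Qed.

(** [b_curve] is exactly the value of [b] for which the dilation by [s] of a
    function with Dirichlet integral [A] has effective constant [1 / s^2]. *)
Lemma kirchhoff_coef s (A : R) : 0 < s -> 0 < A ->
  a + (1 - a * s ^+ 2) / A `^ theta * s `^ (theta * (N%:R - 2) - 2)
      * (s ^+ 2 / s ^+ N * A) `^ theta = (s ^+ 2)^-1.
Proof.
move=> s0 A0.
have sN : s ^+ 2 / s ^+ N = s `^ (2 - N%:R).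
  by rewrite powRB ?(gt_eqF s0) ?implybT// !powR_mulrn ?(ltW s0).
rewrite sN powRM ?powR_ge0 ?(ltW A0)// -powRrM.
have A1 : A `^ theta != 0 by rewrite gt_eqF// powR_gt0.
have s2 : s ^+ 2 != 0 by rewrite gt_eqF// exprn_gt0.
rewrite (_ : _ * _ * _ = (1 - a * s ^+ 2) *
    (s `^ (theta * (N%:R - 2) - 2) * s `^ ((2 - N%:R) * theta))); last first.
  by field.
rewrite -powRD ?(gt_eqF s0) ?implybT//.
rewrite (_ : _ - 2 + _ = - 2%:R); last by ring.
rewrite powR_invn ?(ltW s0)//; field.
by rewrite (gt_eqF s0).
Qed.

Lemma branch_kirchhoff phi s : P_set N g phi -> 0 < dirichlet phi ->
  s_range a s -> kirchhoff g a theta (b_curve a theta phi s) (fun x => phi (s *: x)).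
Proof.
move=> [Dphi wphi poh] A0 /s_rangeP[s0 as1]; have [H1phi _ _] := Dphi.
have mphi : measurable_fun setT phi by have [/Lfun2_measurable] := H1phi.
have coef := kirchhoff_coef s0 A0.
split.
- rewrite /b_curve mulr_ge0 ?powR_ge0// divr_ge0 ?powR_ge0// subr_ge0//.
- exact: D_G_dilate.
- rewrite dirichlet_dilate// /b_curve coef -[X in weak_solution _ X]mul1r.
  exact: weak_solution_dilate.
- rewrite fine_potential_dilate// dirichlet_dilate//.
  set A' := s ^+ 2 / s ^+ N * dirichlet phi.
  have A'0 : 0 < A' by rewrite mulr_gt0// divr_gt0// exprn_gt0.
  rewrite powRD ?(gt_eqF A'0) ?implybT// powRr1 ?(ltW A'0)//.
  rewrite mulrA -mulrDl {1}/b_curve coef /A' [RHS]mulrCA -poh.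
  by field; rewrite ?expf_neq0 (gt_eqF s0).
Qed.

(** The formula for [b] is conditional because this correspondence also holds for
    functions with zero Dirichlet integral, which are excluded only afterwards by
    comparing [phi] with a ground state. *)
Lemma kirchhoff_branch b u : kirchhoff g a theta b u ->
  exists phi s, [/\ P_set N g phi, s_range a s, 0 < dirichlet phi -> b = b_curve a theta phi s
   & u = (fun x => phi (s *: x))].
Proof.
move=> [b0 Du wu poh]; have [H1u _ _] := Du.
have mu1 : measurable_fun setT u by have [/Lfun2_measurable] := H1u.
pose c := a + b * dirichlet u `^ theta.
have bA : 0 <= b * dirichlet u `^ theta by rewrite mulr_ge0// powR_ge0.
have c0 : 0 < c by rewrite /c ltr_pwDl.
pose r := Num.sqrt c; pose s := r^-1.
have r0 : 0 < r by rewrite sqrtr_gt0.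
have s0 : 0 < s by rewrite invr_gt0.
have rc : r ^+ 2 = c by rewrite sqr_sqrtr// ltW.
have uE : u = (fun x => (fun y => u (r *: y)) (s *: x)).
  by apply/funext => x; rewrite scalerA mulfV ?gt_eqF// scale1r.
have Pphi : P_set N g (fun y => u (r *: y)).
  split; first exact: D_G_dilate.
  - have := weak_solution_dilate r0 cg H1u wu.
    by rewrite -/c rc divff// gt_eqF.
  - rewrite fine_potential_dilate// dirichlet_dilate// rc [RHS]mulrCA -poh.
    have [->|A0] := eqVneq (dirichlet u) 0.
      by rewrite powR0 ?(gt_eqF (addr_gt0 theta0 ltr01))// !(mulr0, addr0).
    rewrite powRD ?A0 ?implybT// powRr1 ?dirichlet_ge0// /c.
    by field; rewrite expf_neq0// gt_eqF.
exists (fun y => u (r *: y)), s; split=> //.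
- apply/s_rangeP; split=> //; rewrite /s exprVn rc ler_pdivrMr// mul1r /c.
  by rewrite lerDl.
- move=> A0; have := kirchhoff_coef s0 A0.
  have H1phi := H1_dilate r0 H1u.
  have Au := dirichlet_dilate s0 H1phi; rewrite -uE in Au.
  have Au0 : 0 < dirichlet u by rewrite Au mulr_gt0// divr_gt0// exprn_gt0.
  rewrite -Au -/(b_curve a theta _ s).
  rewrite {2}/s exprVn invrK rc /c => /addrI /mulIf -> //.
  by rewrite gt_eqF// powR_gt0.
Qed.

End correspondence.
(** * The function b along a branch *)

Lemma is_derive_quadratic (R : realType) (c d t : R) :
  is_derive t (1 : R) (fun s => c - d * s ^+ 2) (- (2 * d * t)).
Proof.
have D := is_deriveB (is_derive_cst c t (1 : R))
  (is_deriveZ d (is_deriveX 2 (is_derive_id t (1 : R)))).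
have -> : (fun s => c - d * s ^+ 2) = cst c - d \*: (id ^+ 2).
  by apply/funext => s; rewrite /= exprfctE.
move: D => /is_derive_eq; apply; rewrite !scaleRE sub0r; ring.
Qed.

Section branch_curve.
Context (R : realType) (N : nat) (a theta : R).
Hypotheses (a0 : 0 < a).
Implicit Types (phi : 'rV[R]_N -> R) (s t b : R).
Local Notation p := (theta * (N%:R - 2)).

Section supercritical.
Hypothesis p2 : 2 < p.
Local Notation S := (s_star N a theta).

Let p0 : 0 < p. Proof. by apply: lt_trans p2. Qed.
Let X : R := (p - 2) / (a * p).
Let X0 : 0 < X. Proof. by rewrite divr_gt0// ?subr_gt0// mulr_gt0. Qed.

(* Field identities are proved for an arbitrary positive value of [p], so that the
   side conditions do not mention [theta] and [N]. *)
Ltac pfield := move: (theta * (N%:R - 2)) p0 => ? ?; field; do ?[apply/andP; split]; rewrite gt_eqF//.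

Lemma s_star_gt0 : 0 < S.
Proof. exact: powR_gt0. Qed.

Lemma s_star_sqr : S ^+ 2 = X.
Proof. by rewrite /s_star powR12_sqrt ?(ltW X0)// sqr_sqrtr// ltW. Qed.

Lemma s_star_range : s_range a S.
Proof.
apply/(s_rangeP a0); split; first exact: s_star_gt0.
have -> : a * S ^+ 2 = (p - 2) / p.
  by rewrite s_star_sqr /X; pfield.
by rewrite ler_pdivrMr// mul1r lerBlDr lerDl.
Qed.

Lemma turning_valueE phi : turning_value a theta phi = C_const N a theta / dirichlet phi `^ theta.
Proof.
rewrite /turning_value /b_curve s_star_sqr /C_const -/X.
have -> : S `^ (p - 2) = X `^ ((p - 2) / 2).
  by rewrite /s_star -powRrM [2^-1 * _]mulrC.
rewrite mulrAC; congr (_ / _); congr (_ * _); rewrite /X; pfield.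
Qed.

(** In terms of [y = s^2 / s_star^2] and [al = (p - 2) / 2] the quotient of the two
    sides is [y^al (1 + (1 - y) al)]. Both factors are bounded by exponentials
    with opposite exponents. *)
Lemma b_curve_le phi s : s_range a s -> b_curve a theta phi s <= turning_value a theta phi.
Proof.
move=> /(s_rangeP a0)[s0 as1]; rewrite turning_valueE /b_curve mulrAC.
apply: ler_wpM2r; first by rewrite invr_ge0 powR_ge0.
rewrite /C_const -/X.
pose y := s ^+ 2 / X; have y0 : 0 < y by rewrite divr_gt0// exprn_gt0.
pose al := (p - 2) / 2; have al0 : 0 < al by rewrite divr_gt0// subr_gt0.
have sX : s ^+ 2 = y * X by rewrite /y divfK// gt_eqF.
have -> : s `^ (p - 2) = y `^ al * X `^ al.
  rewrite -(powRM al (ltW y0) (ltW X0)) -sX -powR_mulrn ?(ltW s0)// -powRrM.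
  by congr powR; rewrite /al [RHS]mulrC divfK.
rewrite mulrA -/al; apply: ler_wpM2r; first exact: powR_ge0.
have aE : 1 - a * s ^+ 2 = 2 / p * (1 + (1 - y) * al) by rewrite sX /al /X; pfield.
have z0 : 0 <= 1 + (1 - y) * al.
  have : 0 <= 1 - a * s ^+ 2 by rewrite subr_ge0.
  by rewrite aE pmulr_rge0// divr_gt0.
rewrite aE.
rewrite -[leLHS]mulrA ler_piMr ?divr_ge0 ?(ltW p0)//.
have h1 : 1 + (1 - y) * al <= expR ((1 - y) * al) by exact: expR_ge1Dx.
have h2 : y `^ al <= expR ((y - 1) * al).
  rewrite expRM ge0_ler_powR ?nnegrE ?expR_ge0 ?(ltW y0) ?(ltW al0)//.
  by have := expR_ge1Dx (y - 1); rewrite addrC subrK.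
apply: le_trans (ler_pM z0 (powR_ge0 _ _) h1 h2) _.
by rewrite -expRD -mulrDl addrA subrK subrr mul0r expR0.
Qed.

Definition b_curve_deriv phi t : R := t `^ (p - 3) * ((p - 2) - a * p * t ^+ 2) / dirichlet phi `^ theta.

Lemma is_derive_b_curve phi t : 0 < t -> is_derive t (1 : R) (b_curve a theta phi) (b_curve_deriv phi t).
Proof.
move=> t0.
have D1 := is_derive1_powR (p - 2) t0.
have D2 : is_derive t (1 : R) (fun s => (1 - a * s ^+ 2) / dirichlet phi `^ theta)
   ((- (2 * a * t)) / dirichlet phi `^ theta).
  have D := is_deriveM (is_derive_quadratic 1 a t)
    (is_derive_cst ((dirichlet phi `^ theta)^-1) t (1 : R)).
  by move: D => /is_derive_eq; apply; rewrite !scaleRE mulr0 add0r mulrC.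
have := is_deriveM D2 D1.
move/is_derive_eq; apply.
rewrite !scaleRE /b_curve_deriv.
have -> : t `^ (p - 2) = t * t `^ (p - 3).
  by rewrite -{2}(powRr1 (ltW t0)) -powRD ?(gt_eqF t0) ?implybT//; congr powR; ring.
have -> : p - 2 - 1 = p - 3 by ring.
by rewrite [LHS]addrC; ring.
Qed.

(** The derivative is a positive factor times [(p - 2) - a p t^2], which vanishes
    at [s_star] only; so at [s_star] the second derivative only sees the
    derivative of the quadratic factor. *)
Lemma nondegenerate_turning phi : 0 < dirichlet phi ->
  nondegenerate_turning_point (b_curve a theta phi) (s_range a) S.
Proof.
move=> A0; have At0 : dirichlet phi `^ theta != 0 by rewrite gt_eqF// powR_gt0.
split.
- exact: s_star_range.
- have := is_derive_b_curve phi s_star_gt0; congr (is_derive _ _ _ _).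
  rewrite /b_curve_deriv s_star_sqr (_ : p - 2 - a * p * X = 0) ?mulr0 ?mul0r//.
  by rewrite /X; pfield.
- move=> t /(s_rangeP a0)[t0 _] /(@derive_val _ _ _ _ _ _ _).
  rewrite (@derive_val _ _ _ _ _ _ _ (is_derive_b_curve phi t0)) /b_curve_deriv => /eqP.
  rewrite !mulf_eq0 invr_eq0 (negbTE At0) orbF (gt_eqF (powR_gt0 (p - 3) t0)) /= subr_eq0 => /eqP h.
  apply/eqP; rewrite -(eqrXn2 (n := 2))// ?(ltW t0) ?(ltW s_star_gt0)//.
  rewrite s_star_sqr /X h; apply/eqP; pfield.
- by move=> t; exact: b_curve_le.
exists (S `^ (p - 3) * (- (2 * (a * p) * S)) / dirichlet phi `^ theta).
  rewrite pmulr_llt0 ?invr_gt0 ?powR_gt0// pmulr_rlt0 ?powR_gt0 ?s_star_gt0//.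
  rewrite oppr_lt0; apply: mulr_gt0 s_star_gt0; apply: mulr_gt0 => //.
  exact: mulr_gt0.
apply: (near_eq_is_derive (f := b_curve_deriv phi)).
  near=> t; rewrite derive1E; apply/esym.
  apply: (@derive_val _ _ _ _ _ _ _ (is_derive_b_curve phi _)).
  by near: t; apply: lt_nbhsr; exact: s_star_gt0.
have D1 := is_derive1_powR (p - 3) s_star_gt0.
have D2 : is_derive S (1 : R) (fun s => (p - 2) - a * p * s ^+ 2) (- (2 * (a * p) * S)).
  exact: is_derive_quadratic.
have D3 := is_deriveM (is_deriveM D1 D2) (is_derive_cst ((dirichlet phi `^ theta)^-1) S (1 : R)).
move: D3; move/is_derive_eq; apply.
rewrite !scaleRE mulr0 add0r s_star_sqr.
rewrite (_ : p - 2 - a * p * X = 0) ?mul0r ?addr0; first by rewrite mulrC.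
by rewrite /X; pfield.
Unshelve. all: by end_near. Qed.

End supercritical.

Lemma b_curve_critical phi s : p = 2 ->
  b_curve a theta phi s = (1 - a * s ^+ 2) / dirichlet phi `^ theta.
Proof. by move=> p2; rewrite /b_curve p2 subrr powRr0 mulr1. Qed.

Section subcritical.
Hypothesis p2 : p < 2.

Lemma b_curve_decr phi s t : 0 < dirichlet phi -> 0 < s -> s_range a t -> s < t ->
  b_curve a theta phi t < b_curve a theta phi s.
Proof.
move=> A0 s0 /(s_rangeP a0)[t0 at1] st; rewrite /b_curve.
have Ai : 0 < (dirichlet phi `^ theta)^-1 by rewrite invr_gt0 powR_gt0.
rewrite mulrAC [ltRHS]mulrAC ltr_pM2r//.
have E x : x `^ (p - 2) = (x `^ (2 - p))^-1 by rewrite -powRN opprB.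
have h1 : 1 - a * t ^+ 2 < 1 - a * s ^+ 2.
  by rewrite ltrD2l ltrN2 ltr_pM2l// ltr_pXn2r// nnegrE ltW.
have h2 : t `^ (p - 2) < s `^ (p - 2).
  rewrite !E ltf_pV2 ?posrE ?powR_gt0//.
  by apply: gt0_ltr_powR; rewrite ?subr_gt0// nnegrE ltW.
apply: ltr_pM => //; first by rewrite subr_ge0.
exact: powR_ge0.
Qed.

Lemma b_curve_inj phi s t : 0 < dirichlet phi -> s_range a s -> s_range a t ->
  b_curve a theta phi s = b_curve a theta phi t -> s = t.
Proof.
move=> A0 rs rt E; have [s0 _] := (s_rangeP a0 _).1 rs; have [t0 _] := (s_rangeP a0 _).1 rt.
have [st|ts|//] := ltgtP s t.
- by have := b_curve_decr A0 s0 rt st; rewrite E ltxx.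
- by have := b_curve_decr A0 t0 rs ts; rewrite E ltxx.
Qed.

(** The curve vanishes at the right end [a^(-1/2)] and, because of its negative
    exponent, exceeds [b] near 0; the intermediate value theorem applies. *)
Lemma b_curve_onto phi b : 0 < dirichlet phi -> 0 <= b ->
  exists2 s, s_range a s & b_curve a theta phi s = b.
Proof.
move=> A0 b0; have At0 : 0 < dirichlet phi `^ theta by exact: powR_gt0.
pose f := b_curve a theta phi.
pose e := (Num.sqrt a)^-1.
have sa : 0 < Num.sqrt a by rewrite sqrtr_gt0.
have e0 : 0 < e by rewrite invr_gt0.
have ae : a * e ^+ 2 = 1 by rewrite /e exprVn sqr_sqrtr ?(ltW a0)// divff// gt_eqF.
have fe : f e = 0 by rewrite /f /b_curve ae subrr !mul0r.
pose be := 2 - p; have be0 : 0 < be by rewrite subr_gt0.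
(* With [s0 <= s1] the power is at least [m], and with [s0 <= e / 2] the factor
   [1 - a s0^2] is at least 1/2; the summand 1 only ensures that [m > 0]. *)
pose m := 2 * b * dirichlet phi `^ theta + 1.
have m0 : 0 < m by rewrite ltr_wpDl// !mulr_ge0// ltW.
pose s1 := m `^ (- be^-1); have s10 : 0 < s1 by exact: powR_gt0.
pose s0 := Num.min s1 (e / 2).
have s00 : 0 < s0 by rewrite lt_min s10 divr_gt0.
have s0e : s0 <= e / 2 by rewrite ge_min lexx orbT.
have s0le : s0 <= e by move: s0e e0; clear; lra.
have fs0 : b <= f s0.
  have h1 : 2^-1 <= 1 - a * s0 ^+ 2.
    have : a * s0 ^+ 2 <= a * (e / 2) ^+ 2.
      by rewrite ler_pM2l// ler_pXn2r// nnegrE ?(ltW s00)// divr_ge0// ltW.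
    have -> : a * (e / 2) ^+ 2 = a * e ^+ 2 / 4 by field.
    by rewrite ae; lra.
  have h2 : m <= s0 `^ (p - 2).
    have E x : x `^ (p - 2) = (x `^ be)^-1 by rewrite -powRN opprB.
    rewrite E -[m]invrK lef_pV2 ?posrE ?invr_gt0 ?powR_gt0//.
    have -> : m^-1 = s1 `^ be.
      by rewrite /s1 -powRrM mulNr mulVf ?gt_eqF// powR_inv1// ltW.
    by apply: ge0_ler_powR; rewrite ?(ltW be0) ?nnegrE ?(ltW s00) ?(ltW s10)// ge_min lexx.
  rewrite /f /b_curve mulrAC ler_pdivlMr//.
  have : 2^-1 * m <= (1 - a * s0 ^+ 2) * s0 `^ (p - 2).
    by apply: ler_pM; rewrite ?invr_ge0// ltW.
  apply: le_trans; rewrite /m mulrDr !mulrA mulVf// mul1r; lra.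
have cf : {within `[s0, e], continuous f}.
  apply: derivable_within_continuous => t; rewrite in_itv /= => /andP[st _].
  have t0 : 0 < t by apply: lt_le_trans st.
  exact: (@ex_derive _ _ _ _ _ _ _ (is_derive_b_curve phi t0)).
have [] := @IVT R f s0 e b s0le cf.
  by rewrite ge_min le_max fe b0 fs0 !orbT.
move=> s; rewrite in_itv /= => /andP[ss se] <-; exists s => //.
apply/(s_rangeP a0); split; first exact: lt_le_trans ss.
rewrite -ae ler_pM2l// ler_pXn2r// nnegrE ltW//; exact: lt_le_trans ss.
Qed.

End subcritical.
End branch_curve.
(** * Ground states and thresholds *)

Lemma powRV_le (R : realType) (x y r : R) : 0 < r -> 0 < x -> x <= y ->
  (y `^ r)^-1 <= (x `^ r)^-1.
Proof.
move=> r0 x0 xy; have y0 : 0 < y := lt_le_trans x0 xy.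
rewrite lef_pV2 ?posrE ?powR_gt0//; apply: (ge0_ler_powR (ltW r0)) => //;
  by rewrite nnegrE ltW.
Qed.

Section ground_states.
Context (R : realType) (N : nat) (g : R -> R).
Hypothesis N3 : (3 <= N)%N.
Implicit Types (U V phi : 'rV[R]_N -> R).

Let N0 : 0 < N%:R :> R. Proof. by rewrite ltr0n; apply: leq_trans N3. Qed.

Lemma ground_state_dirichlet U : ground_state g U -> (dirichlet U)%:E = (N%:R%:E * c_g N g)%E.
Proof.
move=> [PU _ _ <-]; rewrite (action_P N3 PU) -EFinM mulrCA divff ?mulr1//.
by rewrite gt_eqF.
Qed.

Lemma ground_state_gt0 U : ground_state g U -> 0 < dirichlet U.
Proof.
move=> [[[H1U _ _] _ _] U0 _ _].
case: N N3 U H1U U0 => [//|n] _ U H1U U0.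
exact: H1_gt0_dirichlet.
Qed.

(** On [P_set] the action is [A / N], so minimizing one minimizes the other. *)
Lemma ground_state_min U phi : ground_state g U -> P_set N g phi -> dirichlet U <= dirichlet phi.
Proof.
move=> [PU _ _ E] Pphi.
have : (c_g N g <= (action g phi)%:E)%E by apply: ereal_inf_lbound; exists phi.
by rewrite -E lee_fin (action_P N3 PU) (action_P N3 Pphi) ler_pM2r// invr_gt0.
Qed.

Lemma ground_state_eq U V : ground_state g U -> ground_state g V -> dirichlet V = dirichlet U.
Proof.
move=> gU gV; have [PU _ _ _] := gU; have [PV _ _ _] := gV.
by apply/le_anti/andP; split; [exact: ground_state_min PU|exact: ground_state_min PV].
Qed.

End ground_states.

Theorem corollary4p5 (R : realType) (N : nat) (a theta : R) (g : R -> R)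
    (U : 'rV[R]_N -> R) :
  (3 <= N)%N -> 0 < a -> 0 < theta -> berestycki_lions N g ->
  ground_state g U ->
  (dirichlet U)%:E = (N%:R%:E * c_g N g)%E /\
  [/\ (2 < theta * (N%:R - 2) ->
       let b_star := C_const N a theta / dirichlet U `^ theta in
       [/\ forall V : 'rV[R]_N -> R, ground_state g V ->
             nondegenerate_turning_point (b_curve a theta V) (s_range a)
               (s_star N a theta) /\
             turning_value a theta V = b_star,
           b_star%:E = ereal_sup
             [set (turning_value a theta phi)%:E | phi in P_set N g],
           upper_threshold N g a theta = b_star%:E &
           forall b : R, b_star < b -> ~ exists u : 'rV[R]_N -> R,
             kirchhoff g a theta b u]),
      (theta * (N%:R - 2) = 2 ->
       let b_0 := dirichlet U `^ (- theta) in
       [/\ upper_threshold N g a theta = b_0%:E,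
           forall V : 'rV[R]_N -> R, ground_state g V ->
             forall b : R, 0 <= b < b_0 -> exists u : 'rV[R]_N -> R,
               branch a theta V (b, u) /\ kirchhoff g a theta b u &
           forall b : R, b_0 <= b -> ~ exists u : 'rV[R]_N -> R,
             kirchhoff g a theta b u]) &
      (theta * (N%:R - 2) < 2 ->
       upper_threshold N g a theta = +oo%E /\
       forall V : 'rV[R]_N -> R, ground_state g V ->
         forall b : R, 0 <= b -> exists u : 'rV[R]_N -> R,
           [/\ branch a theta V (b, u), kirchhoff g a theta b u &
               forall v, branch a theta V (b, v) -> v = u])].
Proof.
move=> N3 a0 theta0 [cg _ _ _ _] gU.
have AU0 := ground_state_gt0 N3 gU.
have PU : P_set N g U by case: gU.
have At0 : 0 < dirichlet U `^ theta by exact: powR_gt0.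
have AP phi : P_set N g phi -> 0 < dirichlet phi.
  by move=> /(ground_state_min N3 gU); exact: lt_le_trans.
have APt phi : P_set N g phi -> (dirichlet phi `^ theta)^-1 <= (dirichlet U `^ theta)^-1.
  by move=> Pphi; exact: (powRV_le theta0 AU0 (ground_state_min N3 gU Pphi)).
have K b (u : 'rV[R]_N -> R) : kirchhoff g a theta b u -> exists phi s,
    [/\ P_set N g phi, s_range a s & b = b_curve a theta phi s].
  move=> /(kirchhoff_branch a0 theta0 cg)[phi [s [Pphi rs E _]]].
  by exists phi, s; split=> //; exact/E/AP.
split; first exact: ground_state_dirichlet.
split.
- move=> p2 b_star.
  have C0 : 0 <= C_const N a theta.
    by rewrite mulr_ge0 ?powR_ge0// divr_ge0// ltW// (lt_trans _ p2).
  have tle phi : P_set N g phi -> turning_value a theta phi <= b_star.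
    by move=> Pphi; rewrite (turning_valueE a0 p2); apply: (ler_wpM2l C0); exact: APt.
  have Kle b (u : 'rV[R]_N -> R) : kirchhoff g a theta b u -> b <= b_star.
    move=> /K[phi [s [Pphi rs ->]]].
    by apply: le_trans (tle _ Pphi); exact: b_curve_le.
  split.
  + move=> V gV; have PV : P_set N g V by case: gV.
    split; first exact: (nondegenerate_turning a0 p2 (AP _ PV)).
    have AV := ground_state_eq N3 gU gV.
    by rewrite (turning_valueE a0 p2) AV.
  + apply/eqP; rewrite eq_le; apply/andP; split.
      by apply: ereal_sup_ubound; exists U; [exact: PU|rewrite (turning_valueE a0 p2)].
    by apply: ge_ereal_sup => _ [phi Pphi <-]; rewrite lee_fin; exact: tle.
  + apply/eqP; rewrite eq_le; apply/andP; split.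
      by apply: ge_ereal_sup => _ [b [u Ku] <-]; rewrite lee_fin; exact: Kle Ku.
    apply: ereal_sup_ubound; exists b_star => //.
    exists (fun x => U (s_star N a theta *: x)).
    have -> : b_star = b_curve a theta U (s_star N a theta).
      by rewrite -/(turning_value a theta U) (turning_valueE a0 p2).
    exact: (branch_kirchhoff theta a0 cg PU AU0 (s_star_range a0 p2)).
  + by move=> b hb [u /Kle]; rewrite leNgt hb.
- move=> p2 b_0.
  have b0E : b_0 = (dirichlet U `^ theta)^-1 by rewrite /b_0 powRN.
  have Klt b (u : 'rV[R]_N -> R) : kirchhoff g a theta b u -> b < b_0.
    move=> /K[phi [s [Pphi /(s_rangeP a0)[s0 _] ->]]].
    rewrite (b_curve_critical a phi s p2) b0E; apply: lt_le_trans (APt _ Pphi).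
    have At1 := powR_gt0 theta (AP _ Pphi).
    rewrite gtr_pMl ?invr_gt0//.
    by rewrite gtrBl mulr_gt0// exprn_gt0.
  have real V (b : R) : ground_state g V -> 0 <= b < b_0 -> exists u : 'rV[R]_N -> R,
      branch a theta V (b, u) /\ kirchhoff g a theta b u.
    move=> gV /andP[b0 bb0]; have PV : P_set N g V by case: gV.
    pose q := 1 - b * dirichlet U `^ theta.
    have q0 : 0 < q by rewrite subr_gt0 -ltr_pdivlMr// mul1r -b0E.
    pose s := Num.sqrt (q / a).
    have s0 : 0 < s by rewrite sqrtr_gt0 divr_gt0.
    have s2 : a * s ^+ 2 = q by rewrite sqr_sqrtr ?divr_ge0 ?ltW// mulrC divfK ?gt_eqF.
    have rs : s_range a s.
      by apply/(s_rangeP a0); rewrite s2 /q gerBl mulr_ge0// ltW.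
    have E : b_curve a theta V s = b.
      have AV := ground_state_eq N3 gU gV.
      by rewrite (b_curve_critical a V s p2) s2 AV /q subKr; apply: mulfK; rewrite gt_eqF.
    exists (fun x => V (s *: x)); split; first by exists s => //; rewrite E.
    by rewrite -E; exact: (branch_kirchhoff theta a0 cg PV (AP _ PV) rs).
  split.
  + apply/eqP; rewrite eq_le; apply/andP; split.
      by apply: ge_ereal_sup => _ [b [u Ku] <-]; rewrite lee_fin; exact: ltW (Klt _ _ Ku).
    have b_00 : 0 < b_0 by rewrite b0E invr_gt0.
    have le_sup b : 0 <= b < b_0 -> (b%:E <= upper_threshold N g a theta)%E.
      move=> hb; apply: ereal_sup_ubound; exists b => //.
      by have [u [_ Ku]] := real U b gU hb; exists u.
    rewrite leNgt; apply/negP; move: (upper_threshold _ _ _ _) le_sup => [r| |] h //.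
      rewrite lte_fin => rb.
      have r0 : 0 <= r by rewrite -lee_fin; apply: h; rewrite lexx.
      have : (((r + b_0) / 2)%:E <= r%:E)%E by apply: h; apply/andP; split; lra.
      rewrite lee_fin; lra.
    by have := h 0; rewrite lexx b_00 => /(_ isT).
  + by move=> V gV b hb; exact: real.
  + by move=> b hb [u /Klt]; rewrite ltNge hb.
- move=> p2.
  have real V (b : R) : ground_state g V -> 0 <= b -> exists u : 'rV[R]_N -> R,
      [/\ branch a theta V (b, u), kirchhoff g a theta b u &
          forall v, branch a theta V (b, v) -> v = u].
    move=> gV b0; have PV : P_set N g V by case: gV.
    have [s rs E] := b_curve_onto a0 p2 (AP _ PV) b0.
    exists (fun x => V (s *: x)); split.
    + by exists s => //; rewrite E.
    + by rewrite -E; exact: (branch_kirchhoff theta a0 cg PV (AP _ PV) rs).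
    + move=> v [t rt [Et <-]]; have Ets := etrans Et (esym E).
      by rewrite (b_curve_inj a0 p2 (AP _ PV) rt rs Ets).
  split; last by move=> V gV b b0; exact: real.
  apply/eqyP => A A0; apply: ereal_sup_ubound; exists A => //.
  by have [u [_ Ku _]] := real U A gU (ltW A0); exists u.
Qed.
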